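(* There is a self-delimiting Turing machine $V$ such that $\zeta_V$ is asymptotically random but not random.
   Context: Turing machines map binary strings to binary strings (partial functions on $\Sigma^*$, $\Sigma=\{0,1\}$); $\mathrm{dom}(M)$ is the set of inputs on which $M$ halts; $M$ is self-delimiting if $\mathrm{dom}(M)$ is prefix-free. $\mathrm{bin}:\mathbf{N}=\{1,2,\dots\}\to\Sigma^*$ sends $n$ to its binary expansion with the leading 1 removed; $\zeta_M=\sum_{n\ge1,\ \mathrm{bin}(n)\in\mathrm{dom}(M)}\frac1n$. A machine $W$ is universal for a class $\Re$ if for every $C\in\Re$ there is $c\ge0$ such that for every $x\in\mathrm{dom}(C)$ there is $p_x\in\mathrm{dom}(W)$ with $|p_x|\le|x|+c$ and $W(p_x)=C(x)$. Fix $T$ universal for all Turing machines and $U$ self-delimiting and universal for self-delimiting machines; $K_T(x)=\min\{|w|:T(w)=x\}$, $H_U(x)=\min\{|w|:U(w)=x\}$. $\alpha[m]$ is the first $m$ bits of the unending binary expansion of $\alpha\in(0,1)$. $\alpha$ is random if there is $c\ge0$ with $H_U(\alpha[m])\ge m-c$ for all $m\ge1$. $\alpha$ is asymptotically random if for every computable real $t>1$ there is $c_t\ge0$ with $K_T(\alpha[m])\ge m/t-c_t$ for all $m\ge1$. *)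

(* Defs.v *)
From HB Require Import structures.
From mathcomp Require Import all_boot all_order all_algebra.
From mathcomp Require Import all_classical all_reals ereal esum.
From mathcomp Require Import zify ring lra.

Set Implicit Arguments.
Unset Strict Implicit.
Unset Printing Implicit Defensive.
Import Order.TTheory GRing.Theory Num.Theory.

Local Open Scope classical_set_scope.
Local Open Scope ring_scope.

(* Deterministic Turing machines with any positive number of two-way infinite
   tapes.  The tape alphabet is {blank} + {0,1} + (auxiliary symbols): None is
   the blank, Some (inl b) is the bit b. *)

Notation cell G := (option (bool + G)).

Inductive move := MoveL | MoveN | MoveR.

(* The scanned cell is the head of [rtape], the cells to its left are listed in
   [ltape] from right to left, and all cells not listed are blank. *)
Record tape (G : Type) := Tape { ltape : seq (cell G); rtape : seq (cell G) }.

Definition tape_read (G : Type) (t : tape G) : cell G := head None (rtape t).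

Definition tape_write (G : Type) (s : cell G) (t : tape G) : tape G :=
  Tape (ltape t) (s :: behead (rtape t)).

Definition tape_move (G : Type) (d : move) (t : tape G) : tape G :=
  match d with
  | MoveL => Tape (behead (ltape t)) (head None (ltape t) :: rtape t)
  | MoveN => t
  | MoveR => Tape (tape_read t :: ltape t) (behead (rtape t))
  end.

(* The machine has [extra_tapes.+1] tapes; it halts when [delta] is None. *)
Record machine := Machine {
  state : finType;
  work : finType;
  extra_tapes : nat;
  start : state;
  delta : state -> {ffun 'I_extra_tapes.+1 -> cell work} ->
          option (state * {ffun 'I_extra_tapes.+1 -> cell work * move})
}.

Record config (M : machine) := Config {
  cstate : state M;
  ctapes : {ffun 'I_(extra_tapes M).+1 -> tape (work M)}
}.

Definition init (M : machine) (x : seq bool) : config M :=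
  @Config M (start M)
    [ffun i => Tape [::] (if i == ord0
                          then [seq Some (inl b) : cell (work M) | b <- x]
                          else [::])].

Definition step (M : machine) (c : config M) : option (config M) :=
  if delta (cstate c) [ffun i => tape_read (ctapes c i)] is Some (q, a) then
    Some (@Config M q
      [ffun i => tape_move (a i).2 (tape_write (a i).1 (ctapes c i))])
  else None.

Fixpoint leading_bits (G : Type) (s : seq (cell G)) : seq bool :=
  if s is Some (inl b) :: s' then b :: leading_bits s' else [::].

(* The output is the maximal block of bits on the first tape that starts at the
   scanned cell, so every halting computation has an output. *)
Definition output (M : machine) (c : config M) : seq bool :=
  leading_bits (rtape (ctapes c ord0)).

Definition computes (M : machine) (x y : seq bool) : Prop :=
  exists (n : nat) (c : config M),
    [/\ iter n (obind (@step M)) (Some (init M x)) = Some c,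
        step c = None & output c = y].

Definition tm_dom (M : machine) : set (seq bool) :=
  [set x | exists y, computes M x y].

Definition prefix_free (A : set (seq bool)) : Prop :=
  forall x y, A x -> A y -> prefix x y -> x = y.

Definition self_delimiting (M : machine) : Prop := prefix_free (tm_dom M).

Definition universal (class : machine -> Prop) (W : machine) : Prop :=
  forall C, class C -> exists c : nat, forall x y, computes C x y ->
    exists p, computes W p y /\ (size p <= size x + c)%N.

(* Binary expansion of n > 0, most significant bit first and without its
   leading 1; [bin 0] is a dummy value. *)
Definition bin (n : nat) : seq bool :=
  [seq odd (n %/ 2 ^ i) | i <- rev (iota 0 (trunc_log 2 n))].

Definition zeta (R : realType) (M : machine) : \bar R :=
  \esum_(n in [set n : nat | (0 < n)%N /\ tm_dom M (bin n)])
    ((n%:R : R)^-1)%:E.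

(* +oo when x is not an output of M. *)
Definition complexity (R : realType) (M : machine) (x : seq bool) : \bar R :=
  ereal_inf [set ((size w)%:R : R)%:E | w in [set w | computes M w x]].

(* The bit of weight 2^-(i+1) of the unending binary expansion of a, meant for
   0 < a <= 1: the first m bits form the largest integer < a * 2^m, so that
   dyadic numbers get the expansion with infinitely many ones. *)
Definition unending_bit (R : realType) (a : R) (i : nat) : bool :=
  odd `|Num.ceil (a * 2 ^+ i.+1) - 1|%N.

Definition first_bits (R : realType) (a : R) (m : nat) : seq bool :=
  mkseq (unending_bit a) m.

(* The strict lower bound for all m forces infinitely many ones. *)
Lemma unending_bitP (R : realType) (a : R) (m : nat) (a01 : 0 < a <= 1) :
  let s : R := \sum_(i < m) (unending_bit a i)%:R / 2 ^+ i.+1 in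
  s < a <= s + 2^-1 ^+ m.
Proof.
have /andP[a0 a1] := a01.
pose c k := `|Num.ceil (a * 2 ^+ k) - 1|%N.
have p2 k : 0 < 2 ^+ k :> R by rewrite exprn_gt0.
have cE k : (c k)%:R < a * 2 ^+ k <= (c k)%:R + 1.
  have /andP[lo hi] := ceil_itv (a * 2 ^+ k).
  have h : 0 <= Num.ceil (a * 2 ^+ k) - 1.
    by rewrite subr_ge0 -gtz0_ge1 ceil_gt0 mulr_gt0.
  have -> : (c k)%:R = (Num.ceil (a * 2 ^+ k) - 1)%:~R :> R.
    by rewrite -[in RHS](gez0_abs h).
  by rewrite lo /= intrB subrK.
have cS k : c k.+1 = (odd (c k.+1) + (c k).*2)%N.
  rewrite -[LHS]odd_double_half; congr (_ + _.*2)%N.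
  have /andP[l1 h1] := cE k.+1; have /andP[l0 h0] := cE k.
  rewrite exprS in l1 h1.
  have u1 : (c k.+1)%:R < ((c k).*2 + 2)%N%:R :> R.
    by rewrite natrD -muln2 natrM; lra.
  have u2 : ((c k).*2)%:R < ((c k.+1).+1)%N%:R :> R.
    by rewrite -natr1 -muln2 natrM; lra.
  by move: u1 u2; rewrite !ltr_nat; lia.
have sE : \sum_(i < m) (unending_bit a i)%:R / 2 ^+ i.+1
    = (c m)%:R / 2 ^+ m :> R.
  elim: m => [|k IH].
    have /andP[l0 _] := cE 0%N; rewrite big_ord0.
    suff -> : c 0%N = 0%N by rewrite mul0r.
    have : (c 0%N)%:R < 1%:R :> R by apply: (lt_le_trans l0); rewrite mulr1.
    by rewrite ltr_nat; lia.
  rewrite big_ord_recr /= IH [in RHS]cS -/(c k.+1) natrD -muln2 natrM exprS.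
  have := p2 k; rewrite /unending_bit -/(c k.+1) => /lt0r_neq0 ?.
  by field.
rewrite /= sE exprVn -[X in _ + X]mul1r -mulrDl.
by rewrite ltr_pdivrMr// ler_pdivlMr//.
Qed.

Definition random (R : realType) (U : machine) (a : R) : Prop :=
  exists2 c : R, 0 <= c &
    forall m : nat, (0 < m)%N ->
      ((m%:R - c)%:E <= complexity R U (first_bits a m))%E.

(* [bin] is a bijection from the positive integers to strings, hence the shift. *)
Definition computable_nat (f : nat -> nat) : Prop :=
  exists M, forall n, computes M (bin n.+1) (bin (f n).+1).

Definition computable_real (R : realType) (t : R) : Prop :=
  exists f g h : nat -> nat,
    [/\ computable_nat f, computable_nat g, computable_nat h &
        forall n, `|t - ((f n)%:R - (g n)%:R) / (h n).+1%:R| <= 2^-1 ^+ n].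

Definition asymptotically_random (R : realType) (T : machine) (a : R) : Prop :=
  forall t : R, computable_real t -> 1 < t ->
    exists2 c : R, 0 <= c &
      forall m : nat, (0 < m)%N ->
        ((m%:R / t - c)%:E <= complexity R T (first_bits a m))%E.

(* Main.v *)
Require Import Defs.
From mathcomp Require Import all_boot all_order all_algebra.
From mathcomp Require Import all_classical all_reals ereal esum.
From mathcomp Require Import zify ring lra.

Set Implicit Arguments.
Unset Strict Implicit.
Unset Printing Implicit Defensive.

(* V halts on the strings 1^(3s+1) 0 u with |u| = s^2 such that T halts on the
   string with code u.  Hence z = zeta_V is the sum of 1/n over numbers n of
   size about 2^(s^2+3s+2), one for each such pair (s, u).
   z is asymptotically random: a program that knows the first m bits of z waits
   for a partial sum of z exceeding them.  By then all T-programs shorter than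
   s^2 that ever halt have halted, where s^2 + 3s + 3 <= m, so one can output a
   string of T-complexity at least s^2 = m - O(sqrt m).
   z is not random: multiplying the terms of block s by 4^s still gives a
   convergent sum O.  Once a partial sum of O is within 2^-(r^2) of O, only blocks
   s >= r are missing and so the same partial sum of z is within 2^-(r^2+2r) of z.
   Thus r^2 bits of O, and two bits for the carry, yield r^2 + 2r bits of z, while
   making this description self-delimiting costs only r + O(1) bits. *)

(** * Turing machines running programs on unary registers *)

(** Block s has at most 2^(s^2) elements, each at least 2^(s^2+3s+2), so its terms sum to at most
    2^-(3s+2). This leaves room for the factor 4^s, after which the blocks still sum to at most 1/2.
    With blocks of size about 2^(s^2), the overhead 3s and the gap between the lengths of
    consecutive blocks are of order s, hence about sqrt m for a prefix of length m. A loss of that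
    order is sublinear, so every rate 1/t survives; a gain of that order is unbounded, so 2r beats
    the self-delimiting cost r plus any constant. [T] is an arbitrary universal machine, so V and
    the two decoders must simulate it step by step, and all three must be exhibited as multitape
    machines. They come from one construction, the search for the least k that passes a computable
    test. Real sums enter these tests through integers: k! clears the denominators of a partial sum
    over numbers below k. *)

Definition store := nat -> nat.
Definition upd (st : store) (i v : nat) : store :=
  fun j => if j == i then v else st j.

(* [While i c] decrements register i before each execution of c, and
   [Read c0 c1] consumes the bit string on the input-output tape. *)
Inductive com :=
| Skip
| Inc of nat
| Seq of com & com
| While of nat & com
| Read of com & com
| Emit of bool.

(* [ev c io st io' st']: from the tape contents [io] and the registers [st], the
   program [c] terminates with [io'] and [st']; [Emit] writes from right to left. *)
Inductive ev : com -> seq bool -> store -> seq bool -> store -> Prop :=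
| EvSkip io st : ev Skip io st io st
| EvInc i io st : ev (Inc i) io st io (upd st i (st i).+1)
| EvSeq c1 c2 io st io1 st1 io2 st2 :
    ev c1 io st io1 st1 -> ev c2 io1 st1 io2 st2 ->
    ev (Seq c1 c2) io st io2 st2
| EvWhile0 i c io st : st i = 0 -> ev (While i c) io st io st
| EvWhileS i c n io st io1 st1 io2 st2 :
    st i = n.+1 -> ev c io (upd st i n) io1 st1 ->
    ev (While i c) io1 st1 io2 st2 -> ev (While i c) io st io2 st2
| EvRead0 c0 c1 st : ev (Read c0 c1) [::] st [::] st
| EvReadS (b : bool) c0 c1 io st io1 st1 io2 st2 :
    ev (if b then c1 else c0) io st io1 st1 ->
    ev (Read c0 c1) io1 st1 io2 st2 ->
    ev (Read c0 c1) (b :: io) st io2 st2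
| EvEmit b io st : ev (Emit b) io st (b :: io) st.

(** [IJz i l] goes to l when register i is 0 and otherwise decrements it and falls through.
    [IRead l1 l] consumes a bit, falling through on 0 and going to l1 on 1; on empty input it goes
    to l. *)
Inductive instr :=
| IInc of nat
| IJz of nat & nat
| IGoto of nat
| IRead of nat & nat
| IEmit of bool.

Fixpoint clen (c : com) : nat :=
  match c with
  | Skip => 0
  | Inc _ | Emit _ => 1
  | Seq c1 c2 => clen c1 + clen c2
  | While _ c => clen c + 2
  | Read c0 c1 => clen c0 + clen c1 + 3
  end.

Fixpoint compile (p : nat) (c : com) : seq instr :=
  match c with
  | Skip => [::]
  | Inc i => [:: IInc i]
  | Emit b => [:: IEmit b]
  | Seq c1 c2 => compile p c1 ++ compile (p + clen c1) c2
  | While i c => IJz i (p + clen c + 2) :: compile p.+1 c ++ [:: IGoto p]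
  | Read c0 c1 =>
      IRead (p + clen c0 + 2) (p + clen c0 + clen c1 + 3)
      :: compile p.+1 c0 ++ IGoto p :: compile (p + clen c0 + 2) c1
      ++ [:: IGoto p]
  end.

Lemma size_compile p c : size (compile p c) = clen c.
Proof.
elim: c p => //= [c1 IH1 c2 IH2|i c IH|c0 IH0 c1 IH1] p.
- by rewrite size_cat IH1 IH2.
- by rewrite size_cat IH /=; lia.
- by rewrite size_cat /= size_cat IH0 IH1 /=; lia.
Qed.

Fixpoint max_reg (c : com) : nat :=
  match c with
  | Skip | Emit _ => 0
  | Inc i => i
  | Seq c1 c2 | Read c1 c2 => maxn (max_reg c1) (max_reg c2)
  | While i c => maxn i (max_reg c)
  end.

Section CodeMachine.
Variables (cd : seq instr) (K : nat).

Notation sym := (cell void).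
Notation stt := ('I_(size cd).+1 * bool)%type.
Definition mark : sym := Some (inl true).

Definition act_on (rd : {ffun 'I_K.+2 -> sym}) (j : nat) (s : sym) (d : move) :
    {ffun 'I_K.+2 -> sym * move} :=
  [ffun i : 'I_K.+2 => if i == inord j then (s, d) else (rd i, MoveN)].

(** A step writes before it moves, whereas a push must move left before it writes. Hence [IInc] and
    [IEmit] take two steps, and the boolean of the state tells them apart. *)
Definition code_delta (q : stt) (rd : {ffun 'I_K.+2 -> sym}) :
    option (stt * {ffun 'I_K.+2 -> sym * move}) :=
  let next (p : nat) ph : stt := (inord p, ph) in
  let p := nat_of_ord q.1 in
  let stay := act_on rd 0 (rd ord0) MoveN in
  if p < size cd then
    Some (match nth (IGoto 0) cd p with
    | IInc i => if q.2 then (next p.+1 false, act_on rd i.+1 mark MoveN)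
                else (next p true, act_on rd i.+1 (rd (inord i.+1)) MoveL)
    | IJz i l => if rd (inord i.+1) == mark
                 then (next p.+1 false, act_on rd i.+1 None MoveR)
                 else (next l false, stay)
    | IGoto l => (next l false, stay)
    | IRead l1 l => if rd ord0 is Some (inl b)
                    then (next (if b then l1 else p.+1) false,
                          act_on rd 0 (rd ord0) MoveR)
                    else (next l false, stay)
    | IEmit b => if q.2 then (next p.+1 false, act_on rd 0 (Some (inl b)) MoveN)
                 else (next p true, act_on rd 0 (rd ord0) MoveL)
    end)
  else None.

(* Tape 0 is the input-output tape and tape i+1 holds register i in unary. *)
Definition code_machine : machine :=
  @Machine stt void K.+1 (inord 0, false) code_delta.

(** The number of trailing blanks is left free, because rewriting a scanned blank turns an empty
    list into an explicit blank cell. *)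
Definition rep_reg (n : nat) (t : tape void) : Prop :=
  exists a b, ltape t = nseq a None /\ rtape t = nseq n mark ++ nseq b None.

(** The left half is unconstrained: bits already consumed stay there until [IEmit] overwrites
    them. *)
Definition rep_io (io : seq bool) (t : tape void) : Prop :=
  exists b, rtape t = [seq Some (inl x) : sym | x <- io] ++ nseq b None.

Definition rep (p : nat) (io : seq bool) (st : store) (c : config code_machine) :=
  [/\ cstate c = (inord p, false) :> stt, rep_io io (ctapes c ord0) &
      forall i, i <= K -> rep_reg (st i) (ctapes c (inord i.+1))].

Definition steps (M : machine) (n : nat) (c c' : config M) :=
  iter n (obind (@step M)) (Some c) = Some c'.

Lemma steps_trans (M : machine) n1 n2 (c1 c2 c3 : config M) :
  steps n1 c1 c2 -> steps n2 c2 c3 -> steps (n1 + n2) c1 c3.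
Proof. by rewrite /steps addnC iterD => -> ->. Qed.

Lemma steps1 (M : machine) (c c' : config M) : step c = Some c' -> steps 1 c c'.
Proof. by []. Qed.

Lemma rep_reg_write n t : rep_reg n t -> rep_reg n (tape_write (tape_read t) t).
Proof.
case=> a [b [el er]]; exists a.
case: n er => [|n] er; rewrite /tape_write /tape_read /= er /=.
  by exists b.-1.+1; split=> //; case: b {er}.
by exists b.
Qed.

Lemma rep_io_write io t : rep_io io t -> rep_io io (tape_write (tape_read t) t).
Proof.
case=> b er; case: io er => [|x io] er; rewrite /rep_io /tape_write /tape_read /= er /=.
  by exists b.-1.+1; case: b {er}.
by exists b.
Qed.

Lemma step_act (c : config code_machine) q j s d :
  delta (cstate c) [ffun i => tape_read (ctapes c i)]
    = Some (q, act_on [ffun i => tape_read (ctapes c i)] j s d) ->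
  step c = Some (@Config code_machine q
    [ffun i => if i == inord j then tape_move d (tape_write s (ctapes c i))
               else tape_write (tape_read (ctapes c i)) (ctapes c i)]).
Proof.
move=> e; rewrite /step e; congr (Some (Config _ _)).
by apply/ffunP => i; rewrite !ffunE; case: eqP => //=; rewrite !ffunE.
Qed.

Lemma inordK' p : p <= size cd -> (inord p : 'I_(size cd).+1) = p :> nat.
Proof. by move=> h; rewrite inordK. Qed.

Lemma inord_tape i j : i <= K.+1 -> j <= K.+1 ->
  ((inord i : 'I_K.+2) == inord j) = (i == j).
Proof. by move=> hi hj; rewrite -val_eqE /= !inordK. Qed.

Lemma ord0_tape i : i <= K -> ((ord0 : 'I_K.+2) == inord i.+1) = false.
Proof. by move=> h; rewrite -val_eqE /= inordK. Qed.

Lemma ord0E : (ord0 : 'I_K.+2) = inord 0.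
Proof. by apply/val_inj; rewrite /= inordK. Qed.

Lemma rep_goto p l io st c : rep p io st c -> p < size cd ->
  nth (IGoto 0) cd p = IGoto l -> exists2 c', steps 1 c c' & rep l io st c'.
Proof.
move=> [eq rio rreg] hp hn.
eexists; first apply/steps1/step_act.
  by rewrite /= /code_delta eq /= (inordK' (ltnW hp)) hp hn.
split=> //=; rewrite ?ffunE.
  by rewrite -ord0E eqxx ?ffunE; apply: rep_io_write.
move=> i hi; rewrite ?ffunE inord_tape //=; apply: rep_reg_write; exact: rreg.
Qed.

Lemma rep_inc p i io st c : rep p io st c -> p < size cd -> i <= K ->
  nth (IGoto 0) cd p = IInc i ->
  exists2 c', steps 2 c c' & rep p.+1 io (upd st i (st i).+1) c'.
Proof.
move=> [eq rio rreg] hp hi hn.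
eexists.
  apply: (@steps_trans _ 1 1); apply/steps1/step_act.
    by rewrite /= /code_delta eq /= (inordK' (ltnW hp)) hp hn.
  by rewrite /= /code_delta /= (inordK' (ltnW hp)) hp hn.
split=> //=; rewrite ?ffunE.
  by rewrite (ord0_tape hi); do 2!apply: rep_io_write.
move=> j hj; rewrite ?ffunE inord_tape // eqSS /upd; case: eqP => [->|ne].
  rewrite ?ffunE ?eqxx.
  have [a [b [el er]]] := rep_reg_write (rreg i hi).
  exists a.-1, b; rewrite /= el; split; first by case: a {el}.
  by congr cons; exact: er.
by do 2!apply: rep_reg_write; apply: rreg.
Qed.

Lemma rep_jz p i l io st c : rep p io st c -> p < size cd -> i <= K ->
  nth (IGoto 0) cd p = IJz i l ->
  exists2 c', steps 1 c c' &
    if st i is n.+1 then rep p.+1 io (upd st i n) c' else rep l io st c'.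
Proof.
move=> [eq rio rreg] hp hi hn.
have [a [b [el er]]] := rreg i hi.
case hst: (st i) er => [|n] er.
  eexists; first apply/steps1/step_act.
    rewrite /= /code_delta eq /= (inordK' (ltnW hp)) hp hn ?ffunE /tape_read er.
    by case: b {er}.
  split=> //=; rewrite ?ffunE.
    by rewrite -ord0E eqxx ?ffunE; apply: rep_io_write.
  move=> j hj; rewrite ?ffunE inord_tape //=; apply: rep_reg_write; exact: rreg.
eexists; first apply/steps1/step_act.
  by rewrite /= /code_delta eq /= (inordK' (ltnW hp)) hp hn ?ffunE /tape_read er /= ?eqxx.
split=> //=; rewrite ?ffunE.
  by rewrite ord0_tape //; apply: rep_io_write.
move=> j hj; rewrite ?ffunE inord_tape // eqSS /upd; case: eqP => [->|ne].
  by exists a.+1, b; rewrite /= el er.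
by apply: rep_reg_write; apply: rreg.
Qed.

Lemma rep_read p l1 l io st c : rep p io st c -> p < size cd ->
  nth (IGoto 0) cd p = IRead l1 l ->
  exists2 c', steps 1 c c' &
    if io is b :: io' then rep (if b then l1 else p.+1) io' st c'
    else rep l io st c'.
Proof.
move=> [eq rio rreg] hp hn.
have [b er] := rio.
case: io er rio => [|x io] er rio.
  eexists; first apply/steps1/step_act.
    rewrite /= /code_delta eq /= (inordK' (ltnW hp)) hp hn ?ffunE /tape_read er.
    by case: b {er}.
  split=> //=; rewrite ?ffunE.
    by have := rep_io_write rio; rewrite -ord0E eqxx /tape_read er.
  move=> j hj; rewrite ?ffunE inord_tape //=; apply: rep_reg_write; exact: rreg.
eexists; first apply/steps1/step_act.
  by rewrite /= /code_delta eq /= (inordK' (ltnW hp)) hp hn ?ffunE /tape_read er /=.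
split=> //=; rewrite ?ffunE.
  by rewrite -ord0E eqxx /=; exists b; rewrite /= er.
move=> j hj; rewrite ?ffunE inord_tape //=; apply: rep_reg_write; exact: rreg.
Qed.

Lemma rep_emit p b io st c : rep p io st c -> p < size cd ->
  nth (IGoto 0) cd p = IEmit b ->
  exists2 c', steps 2 c c' & rep p.+1 (b :: io) st c'.
Proof.
move=> [eq rio rreg] hp hn.
eexists.
  apply: (@steps_trans _ 1 1); apply/steps1/step_act.
    by rewrite /= /code_delta eq /= (inordK' (ltnW hp)) hp hn.
  by rewrite /= /code_delta /= (inordK' (ltnW hp)) hp hn.
split=> //=; rewrite ?ffunE.
  rewrite -ord0E ?eqxx ?ffunE ?eqxx /= ?ffunE.
  have [m er] := rep_io_write rio.
  by exists m; rewrite /= -er.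
move=> j hj; rewrite ?ffunE inord_tape //=.
by do 2!apply: rep_reg_write; apply: rreg.
Qed.

Definition located (p : nat) (s : seq instr) :=
  exists u v, cd = u ++ s ++ v /\ size u = p.

Lemma located_cat p s1 s2 :
  located p (s1 ++ s2) -> located p s1 /\ located (p + size s1) s2.
Proof.
case=> u [v [e su]]; split; first by exists u, (s2 ++ v); rewrite e -catA.
by exists (u ++ s1), v; rewrite e size_cat su -!catA.
Qed.

Lemma located_nth p x s : located p (x :: s) ->
  p < size cd /\ nth (IGoto 0) cd p = x.
Proof.
case=> u [v [e su]]; rewrite e !size_cat su /= nth_cat su ltnn subnn; split=> //; lia.
Qed.

Lemma compile_correct c io st io' st' : ev c io st io' st' ->
  forall p cf, located p (compile p c) -> max_reg c <= K -> rep p io st cf ->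
  exists n cf', steps n cf cf' /\ rep (p + clen c) io' st' cf'.
Proof.
elim=> {c io st io' st'} /=.
- by move=> io st p cf _ _ h; exists 0, cf; rewrite addn0.
- move=> i io st p cf /located_nth[hp hn] hK h.
  by have [c' s r] := rep_inc h hp hK hn; exists 2, c'; rewrite addn1.
- move=> c1 c2 io st io1 st1 io2 st2 _ IH1 _ IH2 p cf /located_cat[l1].
  rewrite size_compile geq_max => l2 /andP[k1 k2] h.
  have [n1 [cf1 [s1 r1]]] := IH1 _ _ l1 k1 h.
  have [n2 [cf2 [s2 r2]]] := IH2 _ _ l2 k2 r1.
  by exists (n1 + n2), cf2; rewrite addnA; split=> //; apply: steps_trans s1 s2.
- move=> i c io st e p cf /located_nth[hp hn].
  rewrite geq_max => /andP[k1 _] h.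
  have [c' s] := rep_jz h hp k1 hn; rewrite e => r.
  by exists 1, c'; rewrite addnA.
- move=> i c n io st io1 st1 io2 st2 e _ IH1 _ IH2 p cf L.
  have [hp hn] := located_nth L.
  rewrite geq_max => /andP[k1 k2] h.
  have [c' s] := rep_jz h hp k1 hn; rewrite e => r.
  move: (L); rewrite -cat1s => /located_cat[_]; rewrite addn1 => /located_cat[L1].
  rewrite size_compile => /located_nth[hp' hn'].
  have [n1 [cf1 [s1 r1]]] := IH1 _ _ L1 k2 r.
  have [c2 s2 r2] := rep_goto r1 hp' hn'.
  have [|n3 [cf3 [s3 r3]]] := IH2 _ _ L _ r2; first by rewrite geq_max k1.
  exists (1 + (n1 + (1 + n3))), cf3; split=> //.
  exact: steps_trans s (steps_trans s1 (steps_trans s2 s3)).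
- move=> c0 c1 st p cf /located_nth[hp hn] k h.
  have [c' s r] := rep_read h hp hn.
  by exists 1, c'; rewrite !addnA.
- move=> b c0 c1 io st io1 st1 io2 st2 _ IH1 _ IH2 p cf L K01 h.
  have [hp hn] := located_nth L.
  move: (K01); rewrite geq_max => /andP[k0 k1].
  have [c' s r] := rep_read h hp hn.
  move: (L); rewrite -cat1s => /located_cat[_]; rewrite addn1 => /located_cat[L0].
  rewrite size_compile => L'.
  have [hg ng] := located_nth L'.
  move: L'; rewrite -cat1s => /located_cat[_]; rewrite /= => /located_cat[L1].
  rewrite size_compile => /located_nth[hg' ng'].
  have [n1 [cf1 [s1 r1]]] : exists n cf', steps n c' cf' /\ rep p io1 st1 cf'.
    clear h; case: b IH1 r => IH1 r.
    - have eL : p.+1 + clen c0 + 1 = p + clen c0 + 2 by lia.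
      rewrite eL in L1 hg' ng'.
      have [n1 [cf1 [s1 r1]]] := IH1 _ _ L1 k1 r.
      have [c2 s2 r2] := rep_goto r1 hg' ng'.
      by exists (n1 + 1), c2; split=> //; apply: steps_trans s1 s2.
    - have [n1 [cf1 [s1 r1]]] := IH1 _ _ L0 k0 r.
      have [c2 s2 r2] := rep_goto r1 hg ng.
      by exists (n1 + 1), c2; split=> //; apply: steps_trans s1 s2.
  have [n2 [cf2 [s2 r2]]] := IH2 _ _ L K01 r1.
  by exists (1 + (n1 + n2)), cf2; split=> //; exact: steps_trans s (steps_trans s1 s2).
- move=> b io st p cf /located_nth[hp hn] hK h.
  by have [c' s r] := rep_emit h hp hn; exists 2, c'; rewrite addn1.
Qed.

Lemma rep_init x : rep 0 x (fun=> 0) (init code_machine x).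
Proof.
split=> //=; first by rewrite ffunE eqxx; exists 0; rewrite cats0.
move=> i hi; rewrite ffunE eq_sym ord0_tape //.
by exists 0, 0.
Qed.

Lemma rep_output p io st c : rep p io st c -> output c = io.
Proof.
case=> _ [b er] _; rewrite /output er; elim: io {er} => //= [|x io ->] //.
by case: b.
Qed.

Lemma rep_halt io st c : rep (size cd) io st c -> step c = None.
Proof. by case=> eq _ _; rewrite /step /= /code_delta eq /= inordK // ltnn. Qed.

End CodeMachine.

Lemma computes_fun (M : machine) x y y' : computes M x y -> computes M x y' -> y = y'.
Proof.
move=> [n [c [sn hc <-]]] [n' [c' [sn' hc' <-]]].
wlog le : n c n' c' sn hc sn' hc' / n <= n'.
  by move=> H; case: (leqP n n') => [|/ltnW] le; [|symmetry]; apply: H le.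
move: sn'; rewrite -(subnK le) iterD sn; case: (n' - n) => [[->]//|k].
have -> : iter k.+1 (obind (@step M)) (Some c) = None.
  by rewrite iterSr /= hc; elim: k => //= k ->.
by [].
Qed.

Lemma updE (st : store) i v j : upd st i v j = if j == i then v else st j.
Proof. by []. Qed.

Lemma ev_cast c io st io' st' st'' :
  ev c io st io' st' -> st' =1 st'' -> ev c io st io' st''.
Proof. by move=> h /funext <-. Qed.

Lemma ev_clear i io st : ev (While i Skip) io st io (upd st i 0).
Proof.
move e: (st i) => n; elim: n st e => [|n IH] st e.
  by apply: ev_cast (EvWhile0 _ _ e) _ => j; rewrite updE; case: eqP => [->|].
apply: EvWhileS e (EvSkip _ _) _.
apply: ev_cast (IH _ _) _; first by rewrite updE eqxx.
by move=> j; rewrite !updE; case: eqP.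
Qed.

Definition move_reg d i := Seq (While i Skip) (While d (Inc i)).

Lemma ev_move d i io st : d != i ->
  ev (move_reg d i) io st io (upd (upd st i (st d)) d 0).
Proof.
move=> ne; apply: EvSeq (ev_clear _ _ _) _.
have loop n : forall m st', st' d = n -> st' i = m ->
    ev (While d (Inc i)) io st' io (upd (upd st' i (n + m)) d 0).
  elim: n => [|n IH] m st' e em.
    apply: ev_cast (EvWhile0 _ _ e) _ => j; rewrite !updE.
    by case: eqP => [->|_]; rewrite ?e //; case: eqP => [->|]; rewrite ?em.
  apply: EvWhileS e (EvInc _ _ _) _.
  apply: ev_cast (IH m.+1 _ _ _) _.
  - by rewrite !updE (negbTE ne) eqxx.
  - by rewrite !updE eqxx eq_sym (negbTE ne) em.
  by move=> j; rewrite !updE addnS addSn; case: (eqVneq j d) => //; case: (eqVneq j i).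
apply: ev_cast (loop (st d) 0 _ _ _) _.
- by rewrite updE (negbTE ne).
- by rewrite updE eqxx.
by move=> j; rewrite !updE addn0; case: (eqVneq j d) => //; case: (eqVneq j i).
Qed.

(* The arguments are in the registers listed in [env], the result goes to
   register [d], and the registers above [d] are a clean work space. *)
Definition computable (f : seq nat -> nat) : Prop :=
  forall env d, all (ltn^~ d) env -> exists c, forall (io : seq bool) (st : store),
    (forall j, d <= j -> st j = 0) ->
    ev c io st io (upd st d (f [seq st i | i <- env])).

Lemma computable_ext f g : f =1 g -> computable f -> computable g.
Proof. by move=> /funext ->. Qed.

Lemma map_env_ext (env : seq nat) d (st st' : store) : all (ltn^~ d) env ->
  (forall j, j < d -> st j = st' j) ->
  [seq st i | i <- env] = [seq st' i | i <- env].
Proof. by move=> /allP h e; apply/eq_in_map => j /h; exact: e. Qed.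

Lemma all_env_leq (env : seq nat) d d' : d <= d' -> all (ltn^~ d) env -> all (ltn^~ d') env.
Proof. by move=> le; apply: sub_all => j /=; lia. Qed.

Lemma computable_zero : computable (fun=> 0).
Proof.
move=> env d _; exists Skip => io st h.
by apply: ev_cast (EvSkip _ _) _ => j; rewrite updE; case: eqP => // ->; apply: h.
Qed.

Lemma computable_succ f : computable f -> computable (fun e => (f e).+1).
Proof.
move=> cf env d hd; have [c hc] := cf _ _ hd; exists (Seq c (Inc d)) => io st h.
apply: EvSeq (hc _ _ h) _; apply: ev_cast (EvInc _ _ _) _ => j.
by rewrite !updE eqxx; case: eqP.
Qed.

Lemma computable_var i : computable (fun e => nth 0 e i).
Proof.
move=> env d hd; case: (ltnP i (size env)) => hi; last first.
  have [c hc] := computable_zero hd; exists c => io st h.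
  by rewrite nth_default ?size_map //; apply: hc.
set j := nth 0 env i; have jd : j < d by move/allP: hd; apply; apply: mem_nth.
(* Reading register j destroys it, so its value is copied to both d and d+1 and then moved back from
   d+1. *)
exists (Seq (While j (Seq (Inc d) (Inc d.+1))) (move_reg d.+1 j)) => io st h.
rewrite (nth_map 0) // -/j.
have loop n : forall m k st', st' j = n -> st' d = m -> st' d.+1 = k ->
    ev (While j (Seq (Inc d) (Inc d.+1))) io st' io
       (upd (upd (upd st' d (n + m)) d.+1 (n + k)) j 0).
  elim: n => [|n IH] m k st' e em ek.
    apply: ev_cast (EvWhile0 _ _ e) _ => x; rewrite !updE.
    by case: eqP => [->|_]; rewrite ?e //; case: eqP => [->|_];
      rewrite ?ek //; case: eqP => [->|]; rewrite ?em.
  apply: EvWhileS e (EvSeq (EvInc _ _ _) (EvInc _ _ _)) _.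
  apply: ev_cast (IH m.+1 k.+1 _ _ _ _) _; rewrite ?updE.
  - by rewrite eqxx (ltn_eqF jd) ltn_eqF // ltnW.
  - by rewrite eqxx em ltn_eqF // gtn_eqF.
  - by rewrite eqxx ek (@gtn_eqF d) // gtn_eqF // ltnW.
  move=> x; rewrite !updE; case: (eqVneq x j) => // _.
  by case: (eqVneq x d.+1) => [_|_]; [lia|case: (eqVneq x d) => //; lia].
apply: EvSeq (loop _ _ _ st erefl (h _ (leqnn d)) (h _ (leqnSn d))) _.
have ne : d.+1 != j by lia.
apply: ev_cast (ev_move _ _ ne) _ => x; rewrite !updE (negbTE ne) eqxx addn0.
case: (eqVneq x d.+1) => [->|_].
  by have -> : (d.+1 == d) = false; [lia|rewrite h].
case: (eqVneq x j) => [->|//].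
by rewrite (ltn_eqF jd).
Qed.

Lemma computable_drop f : computable f -> computable (fun e => f (behead e)).
Proof.
move=> cf env d hd; have [|c hc] := cf (behead env) d.
  by case: env hd => //= a env /andP[].
by exists c => io st h; rewrite behead_map; apply: hc.
Qed.

(** Composition in de Bruijn style: the value of g becomes the first entry of the environment of f,
    whose work space therefore starts one register higher. *)
Lemma computable_let f g :
  computable f -> computable g -> computable (fun e => f (g e :: e)).
Proof.
move=> cf cg env d hd; have [cg' hg] := cg _ _ hd.
have [|cf' hf] := cf (d :: env) d.+1.
  by rewrite /= ltnSn; apply: all_env_leq hd.
exists (Seq cg' (Seq cf' (move_reg d.+1 d))) => io st h.
apply: EvSeq (hg _ _ h) _; set v := g _.
apply: EvSeq (hf _ _ _) _.
  by move=> j hj; rewrite updE gtn_eqF // h // ltnW.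
rewrite /= updE eqxx -(@map_env_ext env d st) //; last first.
  by move=> j hj; rewrite updE ltn_eqF.
apply: ev_cast (ev_move _ _ _) _; first by lia.
move=> j; rewrite !updE eqxx; case: (eqVneq j d.+1) => [->|_].
  by rewrite gtn_eqF // h.
by case: eqP.
Qed.

Lemma computable_rec f g n : computable f -> computable g -> computable n ->
  computable (fun e =>
    nat_rec (fun=> nat) (f e) (fun k r => g (r :: k :: e)) (n e)).
Proof.
move=> cf cg cn env d hd; have [cn' hn] := cn _ _ hd.
have [|cf' hf] := cf env d.+2; first by apply: all_env_leq hd; lia.
have [|cg' hg] := cg (d.+2 :: d.+1 :: env) d.+3.
  by rewrite /= ltnSn /= leqnSn /=; apply: all_env_leq hd; lia.
pose body := Seq cg' (Seq (move_reg d.+3 d.+2) (Inc d.+1)).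
exists (Seq cn' (Seq cf' (Seq (While d body)
  (Seq (While d.+1 Skip) (move_reg d.+2 d))))) => io st h.
set e := [seq st i | i <- env].
have hst st' : (forall j, j < d -> st' j = st j) -> [seq st' i | i <- env] = e.
  by move=> H; apply: (map_env_ext hd) => j; apply: H.
apply: EvSeq (hn _ _ h) _; rewrite -/e.
apply: EvSeq (hf _ _ _) _.
  by move=> j hj; rewrite updE gtn_eqF ?h; lia.
rewrite hst; last by move=> j hj; rewrite updE ltn_eqF.
(* Register d counts down, d+1 holds the index and d+2 the accumulator; d+3 receives each new value
   of g before it is moved to d+2. *)
pose S c k r := upd (upd (upd st d c) d.+1 k) d.+2 r.
pose G m := nat_rec (fun=> nat) (f e) (fun k r => g (r :: k :: e)) m.
have loop m : forall k, ev (While d body) io (S m k (G k)) io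
    (S 0 (k + m) (G (k + m))).
  elim: m => [|m IH] k.
    rewrite addn0; apply: ev_cast (EvWhile0 _ _ _) _ => //.
    by rewrite /S !updE eqxx; do 2!(rewrite ltn_eqF; last lia).
  apply: (@EvWhileS _ _ m _ _ io (S m k.+1 (G k.+1))).
  - by rewrite /S !updE eqxx; do 2!(rewrite ltn_eqF; last lia).
  - apply: (@EvSeq _ _ _ _ io (upd (S m k (G k)) d.+3 (G k.+1))).
      apply: ev_cast (hg _ _ _) _.
        by move=> j hj; rewrite /S !updE; do 3!(rewrite gtn_eqF; last lia); apply: h; lia.
      move=> j; rewrite /= hst; last first.
        by move=> i hi; rewrite /S !updE; do 3!(rewrite ltn_eqF; last lia).
      rewrite /S !updE !eqxx.
      have -> : (d.+2 == d) = false by lia.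
      have -> : (d.+1 == d.+2) = false by lia.
      have -> : (d.+1 == d) = false by lia.
      case: (eqVneq j d) => [->|//].
      by do 3!(rewrite [in RHS]ltn_eqF; last lia); rewrite ltn_eqF //; lia.
    apply: EvSeq (ev_move _ _ _) _; first by lia.
    apply: ev_cast (EvInc _ _ _) _ => j; rewrite /S !updE !eqxx.
    have -> : (d.+1 == d.+3) = false by lia.
    have -> : (d.+1 == d.+2) = false by lia.
    case: (eqVneq j d.+1) => [->|_]; first by have -> : (d.+1 == d.+2) = false by lia.
    case: (eqVneq j d.+3) => [->|_].
      by do 2!(rewrite gtn_eqF; last lia); rewrite h //; lia.
    by case: (eqVneq j d.+2).
  by rewrite addnS -addSn; exact: IH.
apply: (@EvSeq _ _ _ _ io (S 0 (n e) (G (n e)))).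
  rewrite (_ : upd _ _ _ = S (n e) 0 (G 0)); first exact: loop.
  apply/funext => j.
  rewrite /S !updE; case: (eqVneq j d.+2) => // _; case: (eqVneq j d.+1) => [->|//].
  by rewrite gtn_eqF // h; lia.
apply: EvSeq (ev_clear _ _ _) _.
apply: ev_cast (ev_move _ _ _) _; first by lia.
move=> j; rewrite /S !updE !eqxx.
have -> : (d.+2 == d.+1) = false by lia.
case: (eqVneq j d.+2) => [->|_]; first by rewrite gtn_eqF ?h //; lia.
case: (eqVneq j d) => // _; case: (eqVneq j d.+1) => [->|//].
by rewrite h; lia.
Qed.

(** * Closure properties of computable functions *)

Lemma computable_const n : computable (fun=> n).
Proof. by elim: n => [|n]; [exact: computable_zero|exact: computable_succ]. Qed.

Lemma computable_op1 (F : nat -> nat) a :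
  computable (fun e => F (nth 0 e 0)) -> computable a -> computable (fun e => F (a e)).
Proof. exact: computable_let. Qed.

(** Pushing the value of a and then that of b leaves b in front, hence the detour through F with its
    arguments swapped. *)
Lemma computable_op2 (F : nat -> nat -> nat) a b :
  computable (fun e => F (nth 0 e 0) (nth 0 e 1)) ->
  computable a -> computable b -> computable (fun e => F (a e) (b e)).
Proof.
move=> cF ca cb.
have cF' := computable_let (computable_let (computable_drop (computable_drop cF))
  (computable_var 1)) (computable_var 1).
have swap : computable (fun e => F (nth 0 e 1) (nth 0 e 0)).
  have h := computable_let (computable_let cF (computable_var 2)) (computable_var 0).
  exact: computable_ext h.
have h := computable_let (computable_let swap (computable_drop cb)) ca.
exact: computable_ext h.
Qed.

Lemma computable_natrec (G : nat -> nat -> seq nat -> nat) f n :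
  computable f ->
  computable (fun e => G (nth 0 e 1) (nth 0 e 0) (behead (behead e))) ->
  computable n ->
  computable (fun e => nat_rec (fun=> nat) (f e) (fun k r => G k r e) (n e)).
Proof. by move=> cf cG cn; apply: computable_ext (computable_rec cf cG cn). Qed.

Lemma computable_var1 i : computable (fun e => nth 0 (behead e) i).
Proof. exact: computable_drop (computable_var i). Qed.

Lemma computable_add a b :
  computable a -> computable b -> computable (fun e => a e + b e).
Proof.
move=> ca cb.
have h := computable_natrec (G := fun _ r _ => r.+1) ca
  (computable_succ (computable_var 0)) cb.
apply: computable_ext h => e /=; elim: (b e) => //= [|n ->]; by rewrite ?addn0 ?addnS.
Qed.

Lemma computable_pred a : computable a -> computable (fun e => (a e).-1).
Proof.
move=> ca.
have h := computable_natrec (G := fun k _ _ => k) (computable_const 0)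
  (computable_var 1) ca.
by apply: computable_ext h => e /=; case: (a e).
Qed.

Lemma computable_sub a b :
  computable a -> computable b -> computable (fun e => a e - b e).
Proof.
move=> ca cb.
have h := computable_natrec (G := fun _ r _ => r.-1) ca
  (computable_pred (computable_var 0)) cb.
apply: computable_ext h => e /=; elim: (b e) => //= [|n ->]; first by rewrite subn0.
by rewrite subnS.
Qed.

Lemma computable_mul a b :
  computable a -> computable b -> computable (fun e => a e * b e).
Proof.
move=> ca cb.
have h := computable_natrec (G := fun _ r e => r + a e) (computable_const 0)
  (computable_add (computable_var 0) (computable_drop (computable_drop ca))) cb.
by apply: computable_ext h => e /=; elim: (b e) => //= [|n ->]; rewrite ?muln0 // mulnS addnC.
Qed.

Lemma computable_exp a b :
  computable a -> computable b -> computable (fun e => a e ^ b e).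
Proof.
move=> ca cb.
have h := computable_natrec (G := fun _ r e => r * a e) (computable_const 1)
  (computable_mul (computable_var 0) (computable_drop (computable_drop ca))) cb.
by apply: computable_ext h => e /=; elim: (b e) => //= n ->; rewrite expnSr.
Qed.

Lemma computable_fact a : computable a -> computable (fun e => (a e)`!).
Proof.
move=> ca.
have h := computable_natrec (G := fun k r _ => k.+1 * r) (computable_const 1)
  (computable_mul (computable_succ (computable_var 1)) (computable_var 0)) ca.
by apply: computable_ext h => e /=; elim: (a e) => //= n ->; rewrite factS.
Qed.

Lemma computable_not (P : seq nat -> bool) :
  computable (fun e => P e : nat) -> computable (fun e => (~~ P e) : nat).
Proof.
move=> cP; have h := computable_sub (computable_const 1) cP.
by apply: computable_ext h => e; case: (P e).
Qed.

Lemma computable_leq a b :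
  computable a -> computable b -> computable (fun e => (a e <= b e) : nat).
Proof.
move=> ca cb.
have h := computable_sub (computable_const 1) (computable_sub ca cb).
by apply: computable_ext h => e; rewrite /leq; case: (a e - b e) => // n; rewrite subSS sub0n.
Qed.

Lemma computable_and (P Q : seq nat -> bool) :
  computable (fun e => P e : nat) -> computable (fun e => Q e : nat) ->
  computable (fun e => (P e && Q e) : nat).
Proof.
move=> cP cQ; apply: computable_ext (computable_mul cP cQ) => e.
by rewrite mulnb.
Qed.

Lemma computable_eq a b :
  computable a -> computable b -> computable (fun e => (a e == b e) : nat).
Proof.
move=> ca cb.
have h := computable_and (computable_leq ca cb) (computable_leq cb ca).
by apply: computable_ext h => e; rewrite -eqn_leq.
Qed.

Lemma computable_if (P : seq nat -> bool) a b :
  computable (fun e => P e : nat) -> computable a -> computable b ->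
  computable (fun e => if P e then a e else b e).
Proof.
move=> cP ca cb.
have h := computable_add (computable_mul cP ca) (computable_mul (computable_not cP) cb).
by apply: computable_ext h => e; case: (P e); rewrite /= !(mul0n, mul1n, addn0).
Qed.

Lemma computable_sum (F : nat -> seq nat -> nat) n :
  computable (fun e => F (nth 0 e 0) (behead e)) -> computable n ->
  computable (fun e => \sum_(i < n e) F i e).
Proof.
move=> cF cn.
have cF' : computable (fun e => F (nth 0 e 1) (behead (behead e))).
  by apply: computable_ext (computable_drop cF) => e; rewrite nth_behead.
have h := computable_natrec (G := fun k r e => r + F k e) (computable_const 0)
  (computable_add (computable_var 0) cF') cn.
apply: computable_ext h => e /=.
by elim: (n e) => /= [|m ->]; rewrite ?big_ord0 // big_ord_recr.
Qed.

(** The recursion keeps the result of the search below k; the value k itself means that nothing has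
    been found yet. *)
Lemma computable_find (P : nat -> seq nat -> bool) n :
  computable (fun e => P (nth 0 e 0) (behead e) : nat) -> computable n ->
  computable (fun e => find (P^~ e) (iota 0 (n e))).
Proof.
move=> cP cn.
have cP' : computable (fun e => P (nth 0 e 1) (behead (behead e)) : nat).
  by apply: computable_ext (computable_drop cP) => e; rewrite nth_behead.
have h := computable_natrec
  (G := fun k r e => if r < k then r else if P k e then k else k.+1) (computable_const 0)
  (computable_if (computable_leq (computable_succ (computable_var 0)) (computable_var 1))
    (computable_var 0)
    (computable_if cP' (computable_var 1) (computable_succ (computable_var 1)))) cn.
apply: computable_ext h => e /=.
elim: (n e) => [//|m IH]; rewrite [LHS]/= IH.
have -> : iota 0 m.+1 = iota 0 m ++ [:: m].
  by rewrite -addn1 iotaD.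
rewrite find_cat has_find size_iota /=.
by case: ifP => //; case: (P m e); rewrite ?addn0 ?addn1.
Qed.

Lemma find_iota (P : nat -> bool) n i :
  i <= n -> (i < n -> P i) -> (forall j, j < i -> ~~ P j) -> find P (iota 0 n) = i.
Proof.
move=> le Pi nP; apply/eqP; rewrite eqn_leq; apply/andP; split.
  rewrite leqNgt; apply/negP => lt.
  have ltn : i < n by apply: leq_trans lt _; rewrite -{2}(size_iota 0 n) find_size.
  by have := before_find 0 lt; rewrite nth_iota // add0n Pi.
rewrite leqNgt; apply/negP => lt; have := nP _ lt.
have ltn := leq_trans lt le.
have /(nth_find 0) : has P (iota 0 n) by rewrite has_find size_iota.
by rewrite nth_iota // add0n => ->.
Qed.

(** A counter that returns to 0 on reaching b. For b = 0 it never returns, in agreement with the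
    convention that a modulo 0 is a. *)
Lemma computable_mod a b :
  computable a -> computable b -> computable (fun e => a e %% b e).
Proof.
move=> ca cb.
have h := computable_natrec
  (G := fun _ r e => if r.+1 == b e then 0 else r.+1) (computable_const 0)
  (computable_if (computable_eq (computable_succ (computable_var 0))
     (computable_drop (computable_drop cb)))
    (computable_const 0) (computable_succ (computable_var 0))) ca.
apply: computable_ext h => e /=.
elim: (a e) => /= [|m ->]; first by rewrite mod0n.
case: (posnP (b e)) => [->|b0]; first by rewrite !modn0.
rewrite modnS; congr (if _ then _ else _).
rewrite [in RHS](divn_eq m (b e)) -addnS dvdn_addr ?dvdn_mull //.
have lt := ltn_pmod m b0.
apply/eqP/idP => [->|/dvdn_leq-/(_ isT)]; [exact: dvdnn|lia].
Qed.

(** The quotient counts the multiples of b among 1, ..., a. *)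
Lemma computable_div a b :
  computable a -> computable b -> computable (fun e => a e %/ b e).
Proof.
move=> ca cb.
have h := computable_natrec
  (G := fun k r e => ((k.+1 %% b e == 0) && (0 < b e)) + r) (computable_const 0)
  (computable_add (computable_and (computable_eq (computable_mod
     (computable_succ (computable_var 1)) (computable_drop (computable_drop cb)))
     (computable_const 0)) (computable_leq (computable_const 1)
     (computable_drop (computable_drop cb)))) (computable_var 0)) ca.
apply: computable_ext h => e /=.
elim: (a e) => /= [|m ->]; first by rewrite div0n.
case: (posnP (b e)) => [->|b0]; first by rewrite andbF !divn0.
by rewrite andbT divnS.
Qed.

Lemma computable_log a : computable a -> computable (fun e => trunc_log 2 (a e)).
Proof.
move=> ca.
have h := computable_find (P := fun i e => a e < 2 ^ i.+1)
  (computable_leq (computable_succ (computable_drop ca))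
    (computable_exp (computable_const 2) (computable_succ (computable_var 0)))) ca.
apply: computable_ext h => e; apply: find_iota.
- case: (posnP (a e)) => [->|a0]; first by rewrite trunc_log0.
  have := trunc_logP (ltnSn 1) a0; have := ltn_expl (trunc_log 2 (a e)) (ltnSn 1); lia.
- by move=> _; apply: trunc_log_ltn.
- move=> j hj; rewrite -leqNgt.
  case: (posnP (a e)) hj => [->|a0] hj; first by rewrite trunc_log0 in hj.
  by apply: leq_trans (trunc_logP (ltnSn 1) a0); rewrite leq_exp2l.
Qed.

Lemma computable_odd a : computable a -> computable (fun e => odd (a e) : nat).
Proof.
move=> ca; apply: computable_ext (computable_mod ca (computable_const 2)) => e.
by rewrite modn2.
Qed.

(** * The numbering of strings inverse to [bin] *)

Definition code (x : seq bool) : nat := foldl (fun n (b : bool) => n.*2 + b) 1 x.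

Lemma code_gt0 x : 0 < code x.
Proof.
rewrite /code; elim/last_ind: x => // x b; rewrite foldl_rcons; lia.
Qed.

Lemma code_rcons x b : code (rcons x b) = (code x).*2 + b.
Proof. by rewrite /code foldl_rcons. Qed.

Lemma log_code x : trunc_log 2 (code x) = size x.
Proof.
apply: trunc_log_eq => //; elim/last_ind: x => // x b /andP[h1 h2].
rewrite size_rcons code_rcons; move: h1 h2; rewrite !expnS; case: b; lia.
Qed.

Lemma binE n : 0 < n -> bin (n.*2) = rcons (bin n) false /\ bin n.*2.+1 = rcons (bin n) true.
Proof.
move=> n0; rewrite /bin.
have lE b : (b < 2)%N -> trunc_log 2 (n.*2 + b) = (trunc_log 2 n).+1.
  move=> b2; apply: trunc_log_eq => //.
  have /andP[] := trunc_log_bounds (ltnSn 1) n0; rewrite !expnS; lia.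
have sh b : (b < 2)%N ->
  [seq odd ((n.*2 + b) %/ 2 ^ i) | i <- rev (iota 0 (trunc_log 2 n).+1)] =
  rcons [seq odd (n %/ 2 ^ i) | i <- rev (iota 0 (trunc_log 2 n))] (odd b).
  move=> b2; rewrite -[in iota 0 _.+1]add1n iotaD rev_cat map_cat /= cats1 divn1.
  rewrite oddD odd_double -[in iota 1 _](addn0 1) iotaDl -map_rev -map_comp.
  congr rcons; apply: eq_map => i /=.
  by rewrite expnD divnMA; congr (odd (_ %/ _)); lia.
have := lE 0 isT; have := lE 1 isT; rewrite addn0 addn1 => -> ->.
by split; [rewrite -(sh 0) ?addn0|rewrite -(sh 1) ?addn1].
Qed.

Lemma bin_code x : bin (code x) = x.
Proof.
elim/last_ind: x => // x b IH; rewrite code_rcons.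
by have [e0 e1] := binE (code_gt0 x); case: b; rewrite ?addn1 ?addn0 ?e0 ?e1 IH.
Qed.

Lemma code_bin n : 0 < n -> code (bin n) = n.
Proof.
elim: n {-2}n (leqnn n) => [|m IH] n; first by case: n.
move=> le n0; case: (posnP n./2) => [h|h].
  by have -> : n = 1 by lia.
have [e0 e1] := binE h.
have eh := odd_double_half n.
have := IH n./2 _ h; case: (odd n) eh => eh IH'.
  by rewrite -{1}eh add1n e1 code_rcons IH'; lia.
by rewrite -{1}eh add0n e0 code_rcons IH'; lia.
Qed.

Lemma size_bin n : size (bin n) = trunc_log 2 n.
Proof. by rewrite size_map size_rev size_iota. Qed.

(** * Machines performing an unbounded search *)

Definition regs (s : seq nat) : store := nth 0 s.

Lemma computable_regs f (env : seq nat) d : computable f -> all (ltn^~ d) env ->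
  exists c, forall io s, size s <= d ->
    ev c io (regs s) io (upd (regs s) d (f [seq nth 0 s i | i <- env])).
Proof.
move=> cf hd; have [c hc] := cf _ _ hd; exists c => io s le.
by apply: hc => j hj; apply: nth_default; apply: leq_trans hj.
Qed.

Lemma shift_com (b : bool) : exists c, forall io n,
  ev c io (regs [:: n]) io (regs [:: n.*2 + b]).
Proof.
have cf : computable (fun e => nth 0 e 0 + nth 0 e 0 + b).
  apply: computable_add (computable_const _).
  exact: computable_add (computable_var 0) (computable_var 0).
have [c hc] := computable_regs (env := [:: 0]) (d := 1) cf isT.
exists (Seq c (move_reg 1 0)) => io n; apply: EvSeq (hc _ _ _) _ => //=.
apply: ev_cast (ev_move _ _ _) _ => // -[|[|j]]; rewrite /upd /regs /= ?nth_nil //.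
by rewrite addnn.
Qed.

Lemma read_com : exists c, forall x, ev c x (regs [::]) [::] (regs [:: code x]).
Proof.
have [c0 h0] := shift_com false; have [c1 h1] := shift_com true.
(* [Inc 0] supplies the leading 1 of the code, and every bit read then doubles the register. *)
exists (Seq (Inc 0) (Read c0 c1)) => x.
apply: EvSeq (EvInc _ _ _) _.
rewrite (_ : upd _ _ _ = regs [:: 1]); last first.
  by apply/funext => -[|[|j]]; rewrite /upd /regs /= ?nth_nil.
rewrite /code; elim: x 1 => [|b x IH] n /=; first exact: EvRead0.
apply: EvReadS (IH _).
by case: b; [exact: h1|exact: h0].
Qed.

Section Search.
Variables (h : nat -> nat -> bool) (g : nat -> nat -> nat).
Hypothesis ch : computable (fun e => h (nth 0 e 0) (nth 0 e 1) : nat).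
Hypothesis cg : computable (fun e => g (nth 0 e 0) (nth 0 e 1)).

(** Register 2 is the flag of the search loop. [While] has just cleared it, and the body sets it
    again, while advancing k, exactly when the test fails. *)
Lemma body_com : exists c, forall n k io,
  ev c io (regs [:: n; k]) io
    (if h n k then regs [:: n; k] else regs [:: n; k.+1; 1]).
Proof.
have [c hc] := computable_regs (env := [:: 0; 1]) (d := 3) (computable_not ch) isT.
exists (Seq c (While 3 (Seq (Inc 1) (Inc 2)))) => n k io.
apply: EvSeq (hc _ _ _) _ => //=; case: (h n k) => /=.
  apply: ev_cast (EvWhile0 _ _ _) _ => //.
  by move=> [|[|[|[|j]]]]; rewrite /upd /regs /= ?nth_nil.
apply: EvWhileS; [by []|by apply: EvSeq; exact: EvInc|].
apply: ev_cast (EvWhile0 _ _ _) _ => //.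
by move=> [|[|[|[|j]]]]; rewrite /upd /regs /= ?nth_nil.
Qed.

Lemma emit_com : exists c, forall n k, exists st,
  ev c [::] (regs [:: n; k]) (bin (g n k)) st.
Proof.
have cbit : computable (fun e => odd (nth 0 e 0 %/ 2 ^ nth 0 e 1) : nat).
  apply/computable_odd/computable_div; first exact: computable_var.
  by apply: computable_exp (computable_var _); apply: computable_const.
have [cx hx] := computable_regs (env := [:: 0; 1]) (d := 2) cg isT.
have [cl hl] := computable_regs (env := [:: 2]) (d := 3)
  (computable_log (computable_var 0)) isT.
have [cb hb] := computable_regs (env := [:: 2; 4]) (d := 5) cbit isT.
have [cn hn] := computable_regs (env := [:: 2; 4]) (d := 6) (computable_not cbit) isT.
(* Register 3 counts the bits still to be written and register 4 is the position, starting at the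
   lowest bit because [Emit] writes from right to left. Registers 5 and 6 hold the bit and its
   negation, so that the two [While] loops act as a conditional. *)
pose body := Seq cb (Seq cn (Seq (While 5 (Emit true))
  (Seq (While 6 (Emit false)) (Inc 4)))).
exists (Seq cx (Seq cl (While 3 body))) => n k.
set x := g n k; exists (regs [:: n; k; x; 0; trunc_log 2 x]).
apply: EvSeq (hx _ _ _) _ => //=.
rewrite (_ : upd _ _ _ = regs [:: n; k; x]); last first.
  by apply/funext => -[|[|[|j]]]; rewrite /upd /regs /= ?nth_nil.
apply: EvSeq (hl _ _ _) _ => //=.
rewrite (_ : upd _ _ _ = regs [:: n; k; x; trunc_log 2 x; 0]); last first.
  by apply/funext => -[|[|[|[|[|j]]]]]; rewrite /upd /regs /= ?nth_nil.
pose out i := [seq odd (x %/ 2 ^ j) | j <- rev (iota 0 i)].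
suff loop l i : ev (While 3 body) (out i) (regs [:: n; k; x; l; i]) (out (i + l))
    (regs [:: n; k; x; 0; i + l]) by exact: (loop _ 0).
elim: l i => [|l IH] i.
  by rewrite addn0; exact: EvWhile0.
rewrite addnS -addSn; apply: EvWhileS (IH i.+1) => //.
rewrite (_ : upd _ _ _ = regs [:: n; k; x; l; i]); last first.
  by apply/funext => -[|[|[|[|[|j]]]]]; rewrite /upd /regs /= ?nth_nil.
have outS : out i.+1 = odd (x %/ 2 ^ i) :: out i.
  by rewrite /out -[in iota 0 _.+1]addn1 iotaD rev_cat.
apply: EvSeq (hb _ _ _) _ => //=.
rewrite (_ : upd _ _ _ = regs [:: n; k; x; l; i; odd (x %/ 2 ^ i) : nat]); last first.
  by apply/funext => -[|[|[|[|[|[|j]]]]]]; rewrite /upd /regs /= ?nth_nil.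
apply: EvSeq (hn _ _ _) _ => //=.
rewrite outS; set b := odd _.
apply: (@EvSeq _ _ _ _ (if b then b :: out i else out i)
  (regs [:: n; k; x; l; i; 0; ~~ b : nat])).
  case: b => /=.
    apply: EvWhileS; [by []|exact: EvEmit|].
    apply: ev_cast (EvWhile0 _ _ _) _ => //.
    by move=> [|[|[|[|[|[|[|j]]]]]]]; rewrite /upd /regs /= ?nth_nil.
  apply: ev_cast (EvWhile0 _ _ _) _ => //.
  by move=> [|[|[|[|[|[|[|j]]]]]]]; rewrite /upd /regs /= ?nth_nil.
apply: (@EvSeq _ _ _ _ (b :: out i) (regs [:: n; k; x; l; i])).
  case: b => /=.
    apply: ev_cast (EvWhile0 _ _ _) _ => //.
    by move=> [|[|[|[|[|[|[|j]]]]]]]; rewrite /upd /regs /= ?nth_nil.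
  apply: EvWhileS; [by []|exact: EvEmit|].
  apply: ev_cast (EvWhile0 _ _ _) _ => //.
  by move=> [|[|[|[|[|[|[|j]]]]]]]; rewrite /upd /regs /= ?nth_nil.
apply: ev_cast (EvInc _ _ _) _.
by move=> [|[|[|[|[|[|[|j]]]]]]]; rewrite /upd /regs /= ?nth_nil.
Qed.

Lemma steps_nonhalting (M : machine) N (c c1 : config M) n c2 :
  steps N c c1 -> steps n c c2 -> step c2 = None -> N <= n.
Proof.
move=> sN sn hc; rewrite leqNgt; apply/negP => lt.
move: sN; rewrite /steps -(subnK (ltnW lt)) iterD sn.
have -> : N - n = (N - n).-1.+1 by lia.
rewrite iterSr /= hc.
suff -> : iter (N - n).-1 (obind (@step M)) None = None by [].
by elim: _.-1 => //= k ->.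
Qed.

(** Minimization of a computable test. The equivalence also covers divergence: without a suitable k
    there is no output, which is what makes statements about domains possible. *)
Theorem search_machine : exists M : machine, forall x y,
  computes M x y <->
  exists k, [/\ h (code x) k, forall j, j < k -> ~~ h (code x) j &
                y = bin (g (code x) k)].
Proof.
have [cr hr] := read_com; have [cb hb] := body_com; have [ce he] := emit_com.
pose pre := Seq cr (Inc 2).
pose prog := Seq pre (Seq (While 2 cb) ce).
pose cd := compile 0 prog; pose K := max_reg prog.
have Lprog : located cd 0 (compile 0 prog) by exists [::], [::]; rewrite cats0.
have hpre x : ev pre x (regs [::]) [::] (regs [:: code x; 0; 1]).
  apply: EvSeq (hr _) _; apply: ev_cast (EvInc _ _ _) _.
  by move=> [|[|[|j]]]; rewrite /upd /regs /= ?nth_nil.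
have dec2 n k : upd (regs [:: n; k; 1]) 2 0 = regs [:: n; k].
  by apply/funext => -[|[|[|j]]]; rewrite /upd /regs /= ?nth_nil.
have init0 x : rep 0 x (regs [::]) (init (code_machine cd K) x).
  rewrite (_ : regs [::] = fun=> 0); first exact: rep_init.
  by apply/funext => j; rewrite /regs nth_nil.
have halt x k : h (code x) k -> (forall j, j < k -> ~~ h (code x) j) ->
    computes (code_machine cd K) x (bin (g (code x) k)).
  move=> hk nk; have [st hst] := he (code x) k.
  have loop m j : j + m = k ->
      ev (While 2 cb) [::] (regs [:: code x; j; 1]) [::] (regs [:: code x; k]).
    elim: m j => [|m IH] j ej.
      have {ej}-> : j = k by lia.
      apply: EvWhileS; [by []|rewrite dec2; exact: hb|].
      by rewrite hk; exact: EvWhile0.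
    apply: EvWhileS; [by []|rewrite dec2; exact: hb|].
    by rewrite (negbTE (nk j _)); [apply: IH; lia|lia].
  have run : ev prog x (regs [::]) (bin (g (code x) k)) st.
    by apply: EvSeq (hpre x) _; apply: EvSeq (loop k 0 erefl) _.
  have [n [c [sn r]]] := compile_correct run Lprog (leqnn K) (init0 x).
  exists n, c; split=> //; last exact: rep_output r.
  by apply: rep_halt; rewrite size_compile; exact: r.
exists (code_machine cd K) => x y; split; last by case=> k [hk nk ->]; exact: halt.
move=> hy; case: (pselect (exists k, h (code x) k)) => [ex|nex].
  have [k hk mink] := ex_minnP ex; exists k; split=> //.
    by move=> j jk; apply/negP => /mink; rewrite leqNgt jk.
  by apply: computes_fun hy (halt _ _ hk _) => j jk; apply/negP => /mink; rewrite leqNgt jk.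
exfalso; have [n [cn [sn hn _]]] := hy.
have [Lpre] := @located_cat cd 0 (compile 0 pre)
  (compile (0 + clen pre) (While 2 cb) ++ compile (0 + clen pre + clen (While 2 cb)) ce) Lprog.
rewrite size_compile => /located_cat[Lw _].
have [kp [kw _]] : [/\ max_reg pre <= K, max_reg (While 2 cb) <= K & True].
  by rewrite /K /prog /=; split=> //; lia.
(* The relation [ev] says nothing about diverging runs. Instead, the head of the loop is reached
   after at least j steps for every j, which no halting run allows. *)
suff run j : exists N c, [/\ j <= N, steps N (init (code_machine cd K) x) c &
    rep (0 + clen pre) [::] (regs [:: code x; j; 1]) c].
  have [N [c [le sN _]]] := run n.+1.
  by have := steps_nonhalting sN sn hn; lia.
elim: j => [|j [N [c [le sN r]]]].
  by have [N [c [sN r]]] := compile_correct (hpre x) Lpre kp (init0 x); exists N, c.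
have [hp np] := located_nth Lw.
have k2 : 2 <= K by move: kw => /=; rewrite geq_max => /andP[].
have [c1 s1 r1] := rep_jz r hp k2 np.
have [_] := @located_cat cd _ [:: IJz 2 (0 + clen pre + clen cb + 2)]
  (compile (0 + clen pre).+1 cb ++ [:: IGoto (0 + clen pre)]) Lw.
rewrite addn1 => /located_cat[L1].
rewrite size_compile => /located_nth[hp' hn'].
rewrite /= dec2 in r1.
have kb : max_reg cb <= K by move: kw => /=; rewrite geq_max => /andP[].
have [n2 [c2 [s2 r2]]] := compile_correct (hb (code x) j [::]) L1 kb r1.
have [c3 s3 r3] := rep_goto r2 hp' hn'.
exists (N + (1 + (n2 + 1))), c3; split; first lia.
  exact: steps_trans sN (steps_trans s1 (steps_trans s2 s3)).
by move: r3; case: ifP => // hh; case: nex; exists j.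
Qed.
End Search.

(** * Simulation of a Turing machine *)

(** Iterates the pairing of x and y as 2^x (2y + 1), with 0 for the empty list. *)
Fixpoint pack (s : seq nat) : nat :=
  if s is x :: s' then 2 ^ x * (pack s').*2.+1 else 0.

(** The exponent of 2 in n, with value 0 at n = 0, so that entries past the end of a list read as
    0. *)
Definition pack_head (n : nat) : nat := find (fun i => ~~ (2 ^ i.+1 %| n)) (iota 0 n).
Definition pack_tail (n : nat) : nat := n %/ 2 ^ (pack_head n).+1.
Definition pack_nth (j n : nat) : nat := pack_head (iter j pack_tail n).

Lemma pack_headK x s : pack_head (pack (x :: s)) = x.
Proof.
apply: find_iota => [|_|j jx] /=.
- by apply: leq_trans (ltnW (ltn_expl x (ltnSn 1))) _; rewrite leq_pmulr.
- by rewrite expnSr dvdn_pmul2l ?expn_gt0 // dvdn2 /= odd_double.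
- by rewrite negbK; apply: dvdn_mulr; apply: dvdn_exp2l.
Qed.

Lemma pack_tailK x s : pack_tail (pack (x :: s)) = pack s.
Proof.
rewrite /pack_tail pack_headK /= expnSr divnMA mulKn ?expn_gt0 //; lia.
Qed.

Lemma pack_nthK j s : pack_nth j (pack s) = nth 0 s j.
Proof.
rewrite /pack_nth; elim: j s => [|j IH] [|x s] //=; first exact: pack_headK.
  suff -> : pack_tail (iter j pack_tail 0) = 0 by [].
  by elim: j {IH} => //= j ->.
by rewrite -iterS iterSr pack_tailK IH.
Qed.

Lemma pack_inj s t : size s = size t -> pack s = pack t -> s = t.
Proof.
move=> es e; apply: (@eq_from_nth _ 0) => // i _.
by rewrite -!pack_nthK e.
Qed.

Lemma computable_pack_head a : computable a -> computable (fun e => pack_head (a e)).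
Proof.
move=> ca; apply: (computable_find (P := fun i e => ~~ (2 ^ i.+1 %| a e))) (ca).
apply/computable_not/computable_eq; last exact: computable_const.
apply: computable_mod; first exact: computable_drop.
by apply/computable_exp/computable_succ/computable_var; exact: computable_const.
Qed.

Lemma computable_pack_nth j a : computable a -> computable (fun e => pack_nth j (a e)).
Proof.
move=> ca; apply: computable_pack_head; elim: j => //= j IH.
apply: computable_div => //; apply: computable_exp; first exact: computable_const.
exact/computable_succ/computable_pack_head.
Qed.

Lemma computable_pack_cons a b :
  computable a -> computable (fun e => pack (b e)) ->
  computable (fun e => pack (a e :: b e)).
Proof.
move=> ca cb.
have h := computable_mul (computable_exp (computable_const 2) ca)
  (computable_succ (computable_add cb cb)).
by apply: computable_ext h => e; rewrite /= addnn.
Qed.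

Lemma computable_pack_map (I : Type) (s : seq I) (G : I -> seq nat -> nat) b :
  (forall i, computable (G i)) -> computable (fun e => pack (b e)) ->
  computable (fun e => pack ([seq G i e | i <- s] ++ b e)).
Proof.
move=> cG cb; elim: s => //= i s IH.
exact: (computable_pack_cons (b := fun e => [seq G i e | i <- s] ++ b e)).
Qed.

Lemma computable_sum_seq (I : Type) (s : seq I) (G : I -> seq nat -> nat) :
  (forall i, computable (G i)) -> computable (fun e => \sum_(i <- s) G i e).
Proof.
move=> cG; elim: s => [|i s IH].
  by apply: computable_ext (computable_const 0) => e; rewrite big_nil.
by apply: computable_ext (computable_add (cG i) IH) => e; rewrite big_cons.
Qed.

(** Any function on a finite type is computable as a table, written as a sum of indicators. The
    transition function of a machine enters the simulation in this way. *)
Lemma computable_lookup (X : finType) (key F : X -> nat) a :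
  computable a -> computable (fun e => \sum_(x <- enum X) (a e == key x) * F x).
Proof.
move=> ca; apply: computable_sum_seq => x.
apply: computable_mul; last exact: computable_const.
exact: computable_eq ca (computable_const _).
Qed.

Lemma lookupE (X : finType) (key F : X -> nat) x : injective key ->
  \sum_(y <- enum X) (key x == key y) * F y = F x.
Proof.
move=> inj; rewrite big_enum /= (bigD1 x) //= eqxx mul1n big1 ?addn0 // => y ne.
by case: eqP => [/inj e|]; rewrite ?mul0n //; rewrite e eqxx in ne.
Qed.

Lemma code_sum x :
  code x = 2 ^ size x + \sum_(i < size x) nth false x i * 2 ^ (size x - i.+1).
Proof.
elim/last_ind: x => [|x b IH]; first by rewrite big_ord0.
rewrite code_rcons IH size_rcons expnS big_ord_recr /= nth_rcons ltnn eqxx subnn muln1.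
rewrite -mul2n mulnDr -addnA; congr (_ + (_ + _)).
rewrite big_distrr /=; apply: eq_bigr => i _.
by rewrite nth_rcons ltn_ord mulnCA -expnS; congr (_ * 2 ^ _); have := ltn_ord i; lia.
Qed.

Section Simulation.
Variable T : machine.
Notation tau := (extra_tapes T).+1.
Notation sym := (cell (work T)).
Notation view := (state T * {ffun 'I_tau -> sym})%type.

Definition cell_code (c : sym) : nat :=
  match c with None => 0 | Some (inl b) => b.+1 | Some (inr a) => (enum_rank a).+3 end.

Definition base : nat := #|work T|.+3.

Lemma cell_code_inj : injective cell_code.
Proof.
case=> [[[] | a]|] [[[] | a']|] //= [] // e.
by congr (Some (inr _)); apply/enum_rank_inj/val_inj.
Qed.

Lemma cell_code_lt c : cell_code c < base.
Proof. by case: c => [[[] | a]|] //=; rewrite /base !ltnS; apply: ltn_ord. Qed.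

(** A half tape is a number whose lowest digit is the cell nearest to the head. The blank is the
    digit 0, so cells that are not listed are read correctly and moves become multiplication and
    division by [base]. *)
Fixpoint cells_code (s : seq sym) : nat :=
  if s is c :: s' then cell_code c + base * cells_code s' else 0.

Lemma cells_code_head s : cell_code (head None s) = cells_code s %% base.
Proof.
case: s => [|c s] /=; first by rewrite mod0n.
by rewrite addnC mulnC modnMDl modn_small // cell_code_lt.
Qed.

Lemma cells_code_behead s : cells_code (behead s) = cells_code s %/ base.
Proof.
case: s => [|c s] /=; first by rewrite div0n.
by rewrite addnC mulnC divnMDl // divn_small ?addn0 // cell_code_lt.
Qed.

Lemma cells_code_digit s i : cells_code s %/ base ^ i %% base = cell_code (nth None s i).
Proof.
elim: i s => [|i IH] s.
  by rewrite divn1 -cells_code_head nth0.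
by rewrite expnS divnMA -cells_code_behead IH nth_behead.
Qed.

Lemma cells_codeE s :
  cells_code s = \sum_(i < size s) cell_code (nth None s i) * base ^ i.
Proof.
elim: s => [|c s IH]; first by rewrite big_ord0.
rewrite /= big_ord_recl /= muln1 IH big_distrr; congr (_ + _) => /=.
by apply: eq_bigr => i _; rewrite /bump /= add1n expnS mulnCA.
Qed.

Definition config_code (c : config T) : nat :=
  pack ((enum_rank (cstate c) : nat) ::
    [seq cells_code (ltape (ctapes c i)) | i <- enum 'I_tau] ++
    [seq cells_code (rtape (ctapes c i)) | i <- enum 'I_tau] ++ [::]).

Definition get_l (i : 'I_tau) n := pack_nth i.+1 n.
Definition get_r (i : 'I_tau) n := pack_nth (tau + i).+1 n.

Lemma get_state c : pack_nth 0 (config_code c) = enum_rank (cstate c).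
Proof. by rewrite /config_code pack_nthK. Qed.

Lemma get_lE i c : get_l i (config_code c) = cells_code (ltape (ctapes c i)).
Proof.
rewrite /get_l /config_code pack_nthK /= nth_cat size_map size_enum_ord ltn_ord.
by rewrite (nth_map i) ?size_enum_ord // nth_ord_enum.
Qed.

Lemma get_rE i c : get_r i (config_code c) = cells_code (rtape (ctapes c i)).
Proof.
rewrite /get_r /config_code pack_nthK /= cats0 nth_cat size_map size_enum_ord.
rewrite ltnNge leq_addr /= addKn.
by rewrite (nth_map i) ?size_enum_ord // nth_ord_enum.
Qed.

Definition view_of (c : config T) : view :=
  (cstate c, [ffun i => tape_read (ctapes c i)]).

Definition view_code (v : view) : nat :=
  pack ((enum_rank v.1 : nat) :: [seq cell_code (v.2 i) | i <- enum 'I_tau] ++ [::]).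

Lemma view_code_inj : injective view_code.
Proof.
move=> [q f] [q' f'] e; have := pack_inj _ e; rewrite /= !cats0 !size_map.
case/(_ erefl) => /val_inj/enum_rank_inj -> /eq_in_map ef; congr pair.
by apply/ffunP => i; apply: cell_code_inj; apply: ef; rewrite mem_enum.
Qed.

Definition view_num (n : nat) : nat :=
  pack (pack_nth 0 n :: [seq get_r i n %% base | i <- enum 'I_tau] ++ [::]).

Lemma view_numE c : view_num (config_code c) = view_code (view_of c).
Proof.
rewrite /view_num /view_code get_state; congr (pack (_ :: _ ++ _)).
by apply: eq_map => i; rewrite get_rE -cells_code_head ffunE.
Qed.

(* A halted configuration is repeated. *)
Definition action (v : view) : state T * {ffun 'I_tau -> sym * move} :=
  odflt (v.1, [ffun i => (v.2 i, MoveN)]) (delta v.1 v.2).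

Definition move_code (d : move) : nat :=
  match d with MoveL => 0 | MoveN => 1 | MoveR => 2 end.

Definition lookup (F : view -> nat) (n : nat) : nat :=
  \sum_(v <- enum (view : finType)) (view_num n == view_code v) * F v.

Lemma lookup_config F c : lookup F (config_code c) = F (view_of c).
Proof. by rewrite /lookup view_numE; apply: lookupE; apply: view_code_inj. Qed.

Definition new_l (i : 'I_tau) n :=
  let w := lookup (fun v => cell_code ((action v).2 i).1) n in
  let m := lookup (fun v => move_code ((action v).2 i).2) n in
  if m == 0 then get_l i n %/ base else
  if m == 1 then get_l i n else w + base * get_l i n.

Definition new_r (i : 'I_tau) n :=
  let w := lookup (fun v => cell_code ((action v).2 i).1) n in
  let m := lookup (fun v => move_code ((action v).2 i).2) n in
  if m == 0 then get_l i n %% base + base * (w + base * (get_r i n %/ base)) else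
  if m == 1 then w + base * (get_r i n %/ base) else get_r i n %/ base.

Definition step_num (n : nat) : nat :=
  pack (lookup (fun v => enum_rank (action v).1) n ::
    [seq new_l i n | i <- enum 'I_tau] ++ [seq new_r i n | i <- enum 'I_tau] ++ [::]).

Definition advance (c : config T) : config T := odflt c (step c).

Lemma step_numE c : step_num (config_code c) = config_code (advance c).
Proof.
have aE : delta (cstate c) [ffun i => tape_read (ctapes c i)] =
          delta (view_of c).1 (view_of c).2 by [].
have H i : new_l i (config_code c) = cells_code (ltape (ctapes (advance c) i)) /\
    new_r i (config_code c) = cells_code (rtape (ctapes (advance c) i)).
  rewrite /new_l /new_r !lookup_config get_lE get_rE /advance /step aE /action.
  rewrite -!cells_code_behead -!cells_code_head.
  case: (delta _ _) => [[q a]|] /=; last first.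
    (* On a halted configuration the scanned symbol is rewritten; on an empty list this adds an
       explicit blank, and the code stays 0. *)
    rewrite !ffunE /=; split=> //; rewrite /tape_read.
    by case: (rtape _) => //=; rewrite muln0.
  by rewrite !ffunE; case: (a i) => s [].
rewrite /step_num lookup_config [RHS]/config_code.
congr pack; congr cons.
  by rewrite /advance /step aE /action; case: (delta _ _) => [[]|].
by congr (_ ++ (_ ++ _)); apply: eq_map => i; have [] := H i.
Qed.

Definition init_num (y : nat) : nat :=
  pack ((enum_rank (start T) : nat) :: [seq 0 | i <- enum 'I_tau] ++
    [seq (if i == ord0 then
            \sum_(j < trunc_log 2 y)
              (odd (y %/ 2 ^ (trunc_log 2 y - j.+1))).+1 * base ^ j
          else 0) | i : 'I_tau <- enum 'I_tau] ++ [::]).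

Lemma init_numE y : init_num y = config_code (init T (bin y)).
Proof.
rewrite /init_num /config_code.
congr pack; congr cons; congr (_ ++ (_ ++ _)); apply: eq_map => i; rewrite !ffunE //=.
case: eqP => //= _.
rewrite cells_codeE size_map size_bin; apply: eq_bigr => j _; congr (_ * _).
rewrite (nth_map false) ?size_bin //= (nth_map 0) ?size_rev ?size_iota //.
rewrite nth_rev ?size_iota // nth_iota //; have := ltn_ord j; lia.
Qed.

(** The digits 1 and 2 are the two bits; by [leading_bits_size] a search below r is long enough. *)
Definition out_len (r : nat) : nat :=
  find (fun i => ~~ ((0 < r %/ base ^ i %% base) && (r %/ base ^ i %% base <= 2))) (iota 0 r).

Definition out_num (r : nat) : nat :=
  2 ^ out_len r +
  \sum_(i < out_len r) (r %/ base ^ i %% base).-1 * 2 ^ (out_len r - i.+1).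

Lemma leading_bits_nth (s : seq sym) i : i < size (leading_bits s) ->
  nth None s i = Some (inl (nth false (leading_bits s) i)).
Proof. by elim: s i => [|[[b|a]|] s IH] [|i] //=; apply: IH. Qed.

Lemma leading_bits_end (s : seq sym) :
  if nth None s (size (leading_bits s)) is Some (inl b) then False else True.
Proof. by elim: s => [|[[b|a]|] s IH]. Qed.

Lemma leading_bits_size (s : seq sym) : size (leading_bits s) <= cells_code s.
Proof.
elim: s => [|[[b|a]|] s IH] //=; rewrite addSn ltnS.
by apply: leq_trans IH _; rewrite /base mulSn; lia.
Qed.

Lemma out_numE (s : seq sym) : out_num (cells_code s) = code (leading_bits s).
Proof.
have lenE : out_len (cells_code s) = size (leading_bits s).
  apply: find_iota => [|_|j jl]; first exact: leading_bits_size.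
    by rewrite cells_code_digit; move: (leading_bits_end s); case: (nth _ _ _) => [[]|].
  by rewrite cells_code_digit leading_bits_nth //; case: (nth _ _ _).
rewrite code_sum /out_num lenE; congr (_ + _); apply: eq_bigr => i _; congr (_ * _).
by rewrite cells_code_digit leading_bits_nth.
Qed.

Definition config_num (y k : nat) : nat :=
  nat_rec (fun=> nat) (init_num y) (fun _ r => step_num r) k.

(* The code of the output of T on [bin y] if it halts within k steps, else 0. *)
Definition run (y k : nat) : nat :=
  lookup (fun v => (~~ isSome (delta v.1 v.2) : nat)) (config_num y k) *
  out_num (get_r ord0 (config_num y k)).

Lemma config_numE y k : config_num y k = config_code (iter k advance (init T (bin y))).
Proof. by elim: k => [|k IH] /=; rewrite -?init_numE // IH step_numE. Qed.

Lemma runE y k : let c := iter k advance (init T (bin y)) in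
  run y k = if step c is None then code (output c) else 0.
Proof.
rewrite /run config_numE lookup_config get_rE out_numE /step /=.
by case: (delta _ _) => [[q a]|] /=; rewrite ?mul0n ?mul1n.
Qed.

Lemma iter_next n (c c' : config T) :
  iter n (obind (@step T)) (Some c) = Some c' -> iter n advance c = c'.
Proof.
elim: n c' => [|n IH] c' /=; first by case.
case: (iter n _ _) IH => [c1|] //= IH e.
by rewrite (IH _ erefl) /advance e.
Qed.

Lemma next_iter n (c : config T) :
  exists m, iter m (obind (@step T)) (Some c) = Some (iter n advance c).
Proof.
elim: n => [|n [m IH]]; first by exists 0.
rewrite iterS /advance; case e: (step _) => [c'|] /=; last by exists m.
by exists m.+1; rewrite iterS IH.
Qed.

Lemma run_computes y k x : 0 < y -> run y k = code x -> computes T (bin y) x.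
Proof.
move=> y0; rewrite runE; set c := iter _ _ _.
case e: (step c) => [c'|] h; first by have := code_gt0 x; rewrite -h.
have [m hm] := next_iter k (init T (bin y)).
by exists m, c; split=> //; rewrite -(bin_code x) -h bin_code.
Qed.

Lemma computes_run y x : computes T (bin y) x -> exists k, run y k = code x.
Proof. by move=> [n [c [hn hc <-]]]; exists n; rewrite runE (iter_next hn) hc. Qed.

Lemma run_stable y k k' : run y k != 0 -> k <= k' -> run y k' = run y k.
Proof.
rewrite !runE; case e: (step _) => [c'|] // _ le.
rewrite -(subnK le) iterD.
suff -> : iter (k' - k) advance (iter k advance (init T (bin y))) = iter k advance (init T (bin y)).
  by rewrite e.
by elim: (k' - k) => //= m ->; rewrite /advance e.
Qed.

Lemma computable_lookup_num F a : computable a -> computable (fun e => lookup F (a e)).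
Proof.
move=> ca; apply: computable_lookup.
apply: computable_pack_cons; first exact: computable_pack_nth.
apply: computable_pack_map; last exact: computable_const.
move=> i; apply: computable_mod; last exact: computable_const.
exact: computable_pack_nth.
Qed.

Lemma computable_step_num : computable (fun e => step_num (nth 0 e 0)).
Proof.
have cv := computable_var 0.
have cB := computable_const base.
have cl i : computable (fun e => get_l i (nth 0 e 0)) by exact: computable_pack_nth.
have cr i : computable (fun e => get_r i (nth 0 e 0)) by exact: computable_pack_nth.
have cL F := computable_lookup_num F cv.
apply: computable_pack_cons; first exact: computable_lookup_num.
apply: computable_pack_map => [i|].
  apply: computable_if; first exact/computable_eq/computable_const.
    exact: computable_div.
  apply: computable_if => //; first exact/computable_eq/computable_const.
  by apply: computable_add => //; apply: computable_mul.
apply: computable_pack_map => [i|]; last exact: computable_const.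
have cw : computable (fun e => lookup (fun v => cell_code ((action v).2 i).1) (nth 0 e 0)
    + base * (get_r i (nth 0 e 0) %/ base)).
  by apply: computable_add => //; apply: computable_mul => //; apply: computable_div.
apply: computable_if; first exact/computable_eq/computable_const.
  apply: computable_add; first exact: computable_mod.
  exact: computable_mul.
apply: computable_if => //; first exact/computable_eq/computable_const.
exact: computable_div.
Qed.

Lemma computable_init_num a : computable a -> computable (fun e => init_num (a e)).
Proof.
move=> ca; have cL := computable_log ca.
apply: computable_pack_cons; first exact: computable_const.
apply: (@computable_pack_map _ _ (fun _ _ => 0)) => [_|]; first exact: computable_const.
apply: computable_pack_map => [i|]; last exact: computable_const.
case: eqP => _; last exact: computable_const.
apply: (computable_sum (F := fun j e => (odd (a e %/ 2 ^ (trunc_log 2 (a e) - j.+1))).+1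
  * base ^ j)) => //.
apply: computable_mul; last by apply: computable_exp (computable_var _); exact: computable_const.
apply/computable_succ/computable_odd/computable_div; first exact: computable_drop.
apply: computable_exp; first exact: computable_const.
by apply: computable_sub; [exact: (computable_drop cL)|exact/computable_succ/computable_var].
Qed.

Lemma computable_out_num a : computable a -> computable (fun e => out_num (a e)).
Proof.
move=> ca.
have cdig : computable (fun e => a (behead e) %/ base ^ (nth 0 e 0) %% base).
  apply: computable_mod; last exact: computable_const.
  apply: computable_div; first exact: computable_drop.
  by apply: computable_exp (computable_var _); exact: computable_const.
have clen : computable (fun e => out_len (a e)).
  apply: (computable_find (P := fun i e => ~~ ((0 < a e %/ base ^ i %% base) &&
    (a e %/ base ^ i %% base <= 2)))) => //.
  apply/computable_not/computable_and; apply: computable_leq => //; exact: computable_const.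
apply: computable_add; first by apply: computable_exp clen; exact: computable_const.
apply: (computable_sum (F := fun i e => (a e %/ base ^ i %% base).-1
  * 2 ^ (out_len (a e) - i.+1))) => //.
apply: computable_mul; first exact: computable_pred.
apply: computable_exp; first exact: computable_const.
by apply: computable_sub; [exact: (computable_drop clen)|exact/computable_succ/computable_var].
Qed.

Lemma computable_run a b :
  computable a -> computable b -> computable (fun e => run (a e) (b e)).
Proof.
move=> ca cb; apply: computable_op2 ca cb.
have cc : computable (fun e => config_num (nth 0 e 0) (nth 0 e 1)).
  apply: (computable_natrec (f := fun e => init_num (nth 0 e 0))
    (G := fun _ r _ => step_num r)).
  - exact/computable_init_num/computable_var.
  - exact: computable_step_num.
  - exact: computable_var.
apply: computable_mul; first exact: computable_lookup_num.
exact/computable_out_num/computable_pack_nth.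
Qed.
End Simulation.

(** * The three machines of the proof *)

Lemma code_cat x u : exists2 e, e < 2 ^ size u & code (x ++ u) = code x * 2 ^ size u + e.
Proof.
elim/last_ind: u => [|u b [e le IH]]; first by exists 0; rewrite // cats0 muln1 addn0.
exists (e.*2 + b); rewrite size_rcons; first by rewrite expnS; case: b; lia.
by rewrite -rcons_cat code_rcons IH expnS; lia.
Qed.

Section Blocks.
(* Block s consists of the codes of the strings 1^(Q s - 1) 0 u, |u| = L s. *)
Variables Q L : nat -> nat.

(** The factor [2 ^ (Q s).+1 - 2] is the code of 1^(Q s - 1) 0, and multiplying by [2 ^ L s] appends
    L s zeros. *)
Definition block_start s := (2 ^ (Q s).+1 - 2) * 2 ^ L s.
Definition in_block s n := (block_start s <= n) && (n < block_start s + 2 ^ L s).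
(** The value is n when no block contains n; this is why users of [block] test membership in the
    block again. *)
Definition block n := find (in_block^~ n) (iota 0 n).

Hypothesis Q_gt : forall s, s < Q s.

Lemma block_startE s : block_start s + 2 ^ (L s).+1 = 2 ^ (Q s + L s).+1.
Proof.
rewrite /block_start -addSn expnD mulnBl (expnS 2 (L s)) subnK // leq_mul2r.
by rewrite (@leq_exp2l 2 1) ?orbT.
Qed.

Lemma block_start_ge s : 2 ^ (Q s + L s) <= block_start s.
Proof.
have := block_startE s; rewrite !expnS.
have : 2 * 2 ^ L s <= 2 ^ (Q s + L s) by
  rewrite -expnS leq_exp2l // -add1n leq_add2r; have := Q_gt s; lia.
lia.
Qed.

Lemma log_block s n : in_block s n -> trunc_log 2 n = Q s + L s.
Proof.
move=> /andP[h1 h2]; apply: trunc_log_eq => //; apply/andP; split.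
  by apply: leq_trans h1; apply: block_start_ge.
by have := block_startE s; rewrite !expnS; lia.
Qed.

Lemma lt_block s n : in_block s n -> s < n.
Proof.
case/andP => h _; apply: leq_trans h; apply: leq_trans (block_start_ge s).
apply: leq_trans (ltn_expl _ (ltnSn 1)) _.
by rewrite leq_exp2l //; have := Q_gt s; lia.
Qed.

(** An element n of block s satisfies 2^(L s) < 2^(Q s + L s + 1) - n <= 2^(L s + 1). Appending l
    bits scales this distance by 2^l up to the same rounding, so L s' = L s + l, and comparing
    lengths gives equal values of Q. *)
Lemma in_block_prefix s s' x x' : in_block s (code x) -> in_block s' (code x') ->
  prefix x x' -> Q s = Q s'.
Proof.
move=> b b' /prefixP[u e]; have [d dlt ed] := code_cat x u.
have := log_block b; have := log_block b'; rewrite !log_code e size_cat => e1 e2.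
move: b b'; rewrite e ed => /andP[h1 h2] /andP[h3 h4].
have := block_startE s'; have := block_startE s; rewrite -e2 -e1.
move: h1 h2 h3 h4; set c := code x; move: e1 e2 dlt; set l := size u; set n := size x.
set S := block_start s; set S' := block_start s' => e1 e2 dlt h1 h2 h3 h4 E1 E2.
have E1' : S * 2 ^ l + 2 ^ (L s + l).+1 = 2 ^ (n + l).+1.
  by rewrite -!addSn !expnD -mulnDl E1.
have h1' : S * 2 ^ l <= c * 2 ^ l by rewrite leq_mul2r h1 orbT.
have h2' : c.+1 * 2 ^ l <= S * 2 ^ l + 2 ^ (L s + l).
  by rewrite expnD -mulnDl leq_mul2r h2 orbT.
have lt1 : 2 ^ L s' < 2 ^ (L s + l).+1 by move: E2; rewrite (expnS 2 (L s')); lia.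
have lt2 : 2 ^ (L s + l) < 2 ^ (L s').+1.
  by move: E1' h2'; rewrite (expnS 2 (L s + l)) mulSn; lia.
by move: lt1 lt2; rewrite !ltn_exp2l //; lia.
Qed.

Hypothesis Q_inj : injective Q.
Hypothesis QL_inj : injective (fun s => Q s + L s).

Lemma blockE s n : in_block s n -> block n = s.
Proof.
move=> h; apply: find_iota => [|//|j js]; first exact/ltnW/lt_block.
apply/negP => hj; have : Q j + L j = Q s + L s by rewrite -(log_block h) (log_block hj).
by move=> /QL_inj e; rewrite e ltnn in js.
Qed.

Lemma block_prefix_free (A : set (seq bool)) :
  (forall x, A x -> in_block (block (code x)) (code x)) -> prefix_free A.
Proof.
move=> H x y /H hx /H hy p; have /Q_inj e := in_block_prefix hx hy p.
have es : size x = size y.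
  by rewrite -!log_code (log_block hx) (log_block hy) e.
by have := prefixP p => -[u eu]; move: es; rewrite eu size_cat; case: u {eu} => [|b u] /=;
  rewrite ?cats0 //; lia.
Qed.

Hypothesis cQ : computable (fun e => Q (nth 0 e 0)).
Hypothesis cL : computable (fun e => L (nth 0 e 0)).

Lemma computable_block_start a : computable a -> computable (fun e => block_start (a e)).
Proof.
move=> ca; apply: computable_mul.
  apply: computable_sub (computable_const _).
  apply: computable_exp; first exact: computable_const.
  exact/computable_succ/(computable_op1 cQ).
by apply: computable_exp (computable_op1 cL ca); apply: computable_const.
Qed.

Lemma computable_in_block a b : computable a -> computable b ->
  computable (fun e => in_block (a e) (b e) : nat).
Proof.
move=> ca cb; apply: computable_and; first exact/computable_leq/cb/computable_block_start.
apply: computable_leq; first exact: computable_succ.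
apply: computable_add; first exact: computable_block_start.
by apply: computable_exp (computable_op1 cL ca); apply: computable_const.
Qed.

Lemma computable_block a : computable a -> computable (fun e => block (a e)).
Proof.
move=> ca; apply: (computable_find (P := fun s e => in_block s (a e))) => //.
by apply: computable_in_block; [exact: computable_var|exact: computable_drop].
Qed.
End Blocks.

(** * The enumeration behind V and the decoders for prefixes of its sum *)

Section Halting.
Variable T : machine.

Definition vQ s := 3 * s + 2.
Definition vL s := s * s.
Notation vstart := (block_start vQ vL).
Notation vin := (in_block vQ vL).
Notation vblock := (block vQ vL).

Lemma vQ_gt s : s < vQ s. Proof. by rewrite /vQ; lia. Qed.
Lemma vQ_inj : injective vQ. Proof. by move=> s s'; rewrite /vQ; lia. Qed.
Lemma vQL_inj : injective (fun s => vQ s + vL s).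
Proof. by move=> s s'; rewrite /vQ /vL; nia. Qed.
Lemma computable_vQ : computable (fun e => vQ (nth 0 e 0)).
Proof.
apply: computable_add (computable_const _).
by apply: computable_mul (computable_var _); apply: computable_const.
Qed.
Lemma computable_vL : computable (fun e => vL (nth 0 e 0)).
Proof. by apply: computable_mul; exact: computable_var. Qed.

(** At stage k only numbers n < k count, which makes every stage finite. The offsets 0 < y < 2^(s^2)
    in block s are the codes of the strings shorter than s^2; at y = 0 the dummy value [bin 0] is
    the empty string. *)
Definition enumerated (n k : nat) : bool :=
  [&& n < k, vin (vblock n) n & run T (n - vstart (vblock n)) k != 0].

Lemma enumerated_mono n k k' : k <= k' -> enumerated n k -> enumerated n k'.
Proof.
move=> le /and3P[h1 h2 h3]; apply/and3P; split=> //; first exact: leq_trans le.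
by rewrite (run_stable h3 le).
Qed.

Lemma enumerated_block s y k : y < 2 ^ vL s ->
  enumerated (vstart s + y) k = (vstart s + y < k) && (run T y k != 0).
Proof.
move=> h; have hb : vin s (vstart s + y) by rewrite /in_block leq_addr ltn_add2l.
by rewrite /enumerated (blockE vQ_gt vQL_inj hb) hb addKn.
Qed.

Lemma computable_enumerated a b : computable a -> computable b ->
  computable (fun e => enumerated (a e) (b e) : nat).
Proof.
move=> ca cb; have cB := computable_block computable_vQ computable_vL ca.
apply: computable_and; first by apply: computable_leq => //; exact: computable_succ.
apply: computable_and; first exact: computable_in_block computable_vQ computable_vL _ _ _ _.
apply/computable_not/computable_eq; last exact: computable_const.
apply: computable_run => //; apply: computable_sub => //.
exact: computable_block_start computable_vQ computable_vL _ _.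
Qed.

(** This is k! times the partial sum of the w n / n. An enumerated n satisfies 0 < n < k, so the
    division is exact and comparisons of rationals become comparisons of natural numbers. *)
Definition weighted_sum (w : nat -> nat) (k : nat) : nat :=
  \sum_(n < k) enumerated n k * (w n * (k`! %/ n)).

Lemma computable_weighted_sum w a : computable (fun e => w (nth 0 e 0)) ->
  computable a -> computable (fun e => weighted_sum w (a e)).
Proof.
move=> cw ca; apply: (computable_sum (F := fun n e =>
  enumerated n (a e) * (w n * ((a e)`! %/ n)))) => //.
have ca' := computable_drop ca; have cv := computable_var 0.
apply: computable_mul; first exact: computable_enumerated.
apply: computable_mul => //; apply: computable_div => //; exact: computable_fact.
Qed.

Definition vweight n := 4 ^ vblock n.

Lemma computable_vweight : computable (fun e => vweight (nth 0 e 0)).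
Proof.
apply: computable_exp; first exact: computable_const.
exact: computable_block computable_vQ computable_vL _ (computable_var 0).
Qed.

Lemma self_delimiting_machine : exists V, self_delimiting V /\
  forall x, tm_dom V x <-> exists k, enumerated (code x) k.
Proof.
have [V hV] := @search_machine enumerated (fun _ _ => 0)
  (computable_enumerated (computable_var 0) (computable_var 1)) (computable_const 0).
have dom x : tm_dom V x <-> exists k, enumerated (code x) k.
  split; first by case=> y /hV[k [hk _ _]]; exists k.
  case=> k hk; have ex : exists k, enumerated (code x) k by exists k.
  have [m hm min] := ex_minnP ex.
  exists (bin 0); apply/hV; exists m; split=> // j jm.
  by apply/negP => /min; rewrite leqNgt jm.
exists V; split=> //; apply: (@block_prefix_free vQ vL vQ_gt vQ_inj) => x /dom[k].
by case/and3P.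
Qed.

(** The largest s with s^2 + 3s + 3 <= m, or 0 if there is none. The bound s^2 + 3s + 3 is
    [(vQ s + vL s).+1], so all elements of block s are below 2^m when s is positive. *)
Definition max_block m : nat :=
  find (fun s => m < s.+1 * s.+1 + 3 * s.+1 + 3) (iota 0 m).

Lemma max_blockP m (s := max_block m) :
  m < s * s + 5 * s + 7 /\ (0 < s -> s * s + 3 * s + 3 <= m).
Proof.
have hm : m < s.+1 * s.+1 + 3 * s.+1 + 3.
  case: (boolP (has (fun s => m < s.+1 * s.+1 + 3 * s.+1 + 3) (iota 0 m))) => h.
    have := nth_find 0 h; rewrite has_find size_iota in h.
    by rewrite nth_iota ?add0n.
  by move: h; rewrite has_find -leqNgt size_iota -/(max_block m) -/s; nia.
split; first by nia.
move=> s0; have lt : s.-1 < max_block m by rewrite -/s; lia.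
have := before_find 0 lt; rewrite nth_iota; last first.
  by apply: leq_trans lt _; rewrite -[leqRHS](size_iota 0) find_size.
by rewrite add0n prednK //; lia.
Qed.

Lemma computable_max_block a : computable a -> computable (fun e => max_block (a e)).
Proof.
move=> ca; apply: (computable_find
  (P := fun s e => a e < s.+1 * s.+1 + 3 * s.+1 + 3)) => //.
have cs := computable_succ (computable_var 0).
apply: computable_leq; first exact/computable_succ/computable_drop.
apply: computable_add (computable_const _); apply: computable_add.
  exact: computable_mul.
by apply: computable_mul cs; exact: computable_const.
Qed.

(** If T outputs a string of m bits with value v, then o = 2^m + v, and the test says that the
    partial sum exceeds v / 2^m. *)
Definition overtake_test n k := let o := run T n k in let m := trunc_log 2 o in
  (o != 0) && ((o - 2 ^ m) * k`! < weighted_sum (fun=> 1) k * 2 ^ m).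

(* Larger than the code of every output of a short program that halts within k
   steps. *)
Definition fresh_output n k :=
  (\sum_(y < 2 ^ vL (max_block (trunc_log 2 (run T n k)))) run T y k).+1.

Lemma fresh_output_machine : exists M, forall x y, computes M x y <->
  exists k, [/\ overtake_test (code x) k, forall j, j < k -> ~~ overtake_test (code x) j &
                y = bin (fresh_output (code x) k)].
Proof.
have v0 := computable_var 0; have v1 := computable_var 1.
have cr := computable_run T v0 v1; have cl := computable_log cr.
have c2 a : computable a -> computable (fun e => 2 ^ a e).
  by apply: computable_exp; exact: computable_const.
apply: search_machine.
  apply: computable_and.
    by apply/computable_not/computable_eq => //; exact: computable_const.
  apply: computable_leq.
    apply/computable_succ/computable_mul; last exact: computable_fact.
    by apply: computable_sub => //; exact: c2.
  apply: computable_mul; last exact: c2.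
  by apply: computable_weighted_sum => //; exact: computable_const.
apply/computable_succ/(computable_sum (F := fun y e => run T y (nth 0 e 1))).
  by apply: computable_run (computable_var1 1).
apply: c2; apply: computable_op1 computable_vL _.
exact: computable_max_block.
Qed.

(** A description is 1^r 0, then r^2 bits for the numerator a of an approximation a / 2^(r^2) of O,
    then the two carry bits. *)
Definition dQ r := r.+1.
Definition dL r := r * r + 2.
Notation dstart := (block_start dQ dL).
Notation din := (in_block dQ dL).
Notation dblock := (block dQ dL).

Lemma dQ_gt r : r < dQ r. Proof. by []. Qed.
Lemma dQ_inj : injective dQ. Proof. by move=> r r' []. Qed.
Lemma dQL_inj : injective (fun r => dQ r + dL r).
Proof. by move=> r r'; rewrite /dQ /dL; nia. Qed.
Lemma computable_dQ : computable (fun e => dQ (nth 0 e 0)).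
Proof. exact/computable_succ/computable_var. Qed.
Lemma computable_dL : computable (fun e => dL (nth 0 e 0)).
Proof.
apply: computable_add (computable_const _).
by apply: computable_mul; exact: computable_var.
Qed.

Definition describes r a k := a * k`! <= weighted_sum vweight k * 2 ^ (r * r).
Definition describe_test n k := let r := dblock n in
  din r n && describes r ((n - dstart r) %/ 4) k.
(* The last two bits of the description correct the approximation of the prefix
   by -1, 0 or 1. *)
Definition described_prefix n k := let r := dblock n in let m := r * r + 2 * r in
  2 ^ m + (weighted_sum (fun=> 1) k * 2 ^ m %/ k`! + (n - dstart r) %% 4).-1.

Lemma description_machine : exists2 M, self_delimiting M & forall x y, computes M x y <->
  exists k, [/\ describe_test (code x) k, forall j, j < k -> ~~ describe_test (code x) j &
                y = bin (described_prefix (code x) k)].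
Proof.
have v0 := computable_var 0; have v1 := computable_var 1.
have c2 a : computable a -> computable (fun e => 2 ^ a e).
  by apply: computable_exp; exact: computable_const.
have cb := computable_block computable_dQ computable_dL v0.
have co : computable (fun e => nth 0 e 0 - dstart (dblock (nth 0 e 0))).
  apply: computable_sub => //.
  exact: computable_block_start computable_dQ computable_dL _ _.
have crr := computable_mul cb cb.
have [||M hM] := @search_machine describe_test described_prefix.
- apply: computable_and; first exact: computable_in_block computable_dQ computable_dL _ _ _ _.
  apply: computable_leq; apply: computable_mul.
  + by apply: computable_div => //; exact: computable_const.
  + exact: computable_fact.
  + exact: computable_weighted_sum computable_vweight _.
  + exact: c2.
- have cm : computable (fun e => dblock (nth 0 e 0) * dblock (nth 0 e 0)
      + 2 * dblock (nth 0 e 0)).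
    apply: computable_add => //; apply: computable_mul => //; exact: computable_const.
  apply: computable_add; first exact: c2.
  apply/computable_pred/computable_add.
    apply: computable_div; last exact: computable_fact.
    apply: computable_mul; last exact: c2.
    by apply: computable_weighted_sum => //; exact: computable_const.
  by apply: computable_mod => //; exact: computable_const.
exists M => //; apply: (@block_prefix_free dQ dL dQ_gt dQ_inj) => x [y] /hM[k [h _ _]].
by case/andP: h.
Qed.

Lemma description_machineP (M : machine) : (forall x y, computes M x y <->
  exists k, [/\ describe_test (code x) k, forall j, j < k -> ~~ describe_test (code x) j &
                y = bin (described_prefix (code x) k)]) ->
  forall r a k b, a < 2 ^ (r * r) -> describes r a k ->
  (forall j, j < k -> ~~ describes r a j) -> b < 4 ->
  exists2 x, size x = r * r + r + 3 &
    let m := r * r + 2 * r in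
    computes M x (bin (2 ^ m + (weighted_sum (fun=> 1) k * 2 ^ m %/ k`! + b).-1)).
Proof.
move=> hM r a k b ha hk nk hb.
pose n := dstart r + (4 * a + b).
have lt : 4 * a + b < 2 ^ dL r.
  by rewrite /dL expnD; move: ha hb; lia.
have bn : din r n by rewrite /in_block leq_addr ltn_add2l.
have en := blockE dQ_gt dQL_inj bn.
have n0 : 0 < n by have := lt_block dQ_gt bn; lia.
have hd : (n - dstart r) %/ 4 = a by rewrite /n addKn mulnC divnMDl // divn_small ?addn0.
have hm : (n - dstart r) %% 4 = b by rewrite /n addKn mulnC modnMDl modn_small.
exists (bin n).
  by rewrite size_bin (log_block dQ_gt bn) /dQ /dL; lia.
apply/hM; exists k; rewrite code_bin // /describe_test /described_prefix en hd hm bn; split=> //.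
Qed.
End Halting.

(** * The sums *)

Import Order.TTheory GRing.Theory Num.Theory.
Local Open Scope classical_set_scope.
Local Open Scope ring_scope.

Lemma sum_uniq_subset (R : realType) (r s : seq nat) (f : nat -> R) :
  uniq r -> uniq s -> {subset r <= s} -> (forall n, 0 <= f n) ->
  \sum_(n <- r) f n <= \sum_(n <- s) f n.
Proof.
move=> ur us rs f0.
have p : perm_eq r [seq n <- s | n \in r].
  apply: uniq_perm => //; first exact: filter_uniq.
  by move=> n; rewrite mem_filter; case: (boolP (n \in r)) => //= /rs ->.
rewrite (perm_big _ p) big_filter big_mkcond; apply: ler_sum => n _.
by case: ifP.
Qed.

Lemma geometric_half (R : realType) (k : nat) :
  \sum_(s < k) (2^-1 : R) ^+ s.+2 <= 2^-1.
Proof.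
have -> : \sum_(s < k) (2^-1 : R) ^+ s.+2 = 2^-1 - 2^-1 ^+ k.+1.
  elim: k => [|k IH]; first by rewrite big_ord0 expr1 subrr.
  by rewrite big_ord_recr /= IH !(exprS _ k.+1); lra.
by rewrite gerBl exprn_ge0.
Qed.

Section Sums.
Variables (R : realType) (T : machine).
Notation vblock := (block vQ vL).
Notation enum_by := (enumerated T).

Definition partial_sum (w : nat -> nat) (k : nat) : R :=
  \sum_(n < k | enum_by n k) (w n)%:R / n%:R.

Lemma enumerated_gt0 n k : enum_by n k -> (0 < n)%N.
Proof. by case/and3P => _ /(lt_block vQ_gt) h _; apply: leq_ltn_trans h. Qed.

Lemma enumerated_lt n k : enum_by n k -> (n < k)%N.
Proof. by case/and3P. Qed.

Lemma weighted_sumE w k : (weighted_sum T w k)%:R = k`!%:R * partial_sum w k.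
Proof.
rewrite /weighted_sum /partial_sum natr_sum big_distrr [RHS]big_mkcond /=.
apply: eq_bigr => n _; case: ifP => h; last by rewrite mul0n.
rewrite mul1n natrM natf_div; first by rewrite mulrCA.
by apply: dvdn_fact; rewrite (enumerated_gt0 h) ltnW.
Qed.

Lemma partial_sum_widen w k K : (k <= K)%N ->
  partial_sum w k = \sum_(n < K | enum_by n k) (w n)%:R / n%:R.
Proof.
move=> le; rewrite /partial_sum.
rewrite (big_ord_widen_cond K (fun n => enum_by n k) (fun n => (w n)%:R / n%:R)) //.
by apply: eq_bigl => n; case: (boolP (enum_by n k)) => // /enumerated_lt ->.
Qed.

Lemma partial_sumB w k K : (k <= K)%N ->
  partial_sum w K - partial_sum w k =
  \sum_(n < K | enum_by n K && ~~ enum_by n k) (w n)%:R / n%:R.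
Proof.
move=> le; rewrite (partial_sum_widen w le) /partial_sum.
rewrite (bigID (fun n : 'I_K => enum_by n k) (fun n : 'I_K => enum_by n K)) /=.
rewrite (eq_bigl (fun n : 'I_K => enum_by n k)); first by rewrite addrC addrK.
by move=> n; case: (boolP (enum_by n k)) => h; rewrite ?andbF // (enumerated_mono le h).
Qed.

Lemma term_ge0 (w : nat -> nat) n : 0 <= (w n)%:R / n%:R :> R.
Proof. by rewrite divr_ge0. Qed.

Lemma partial_sum_mono w k K : (k <= K)%N -> partial_sum w k <= partial_sum w K.
Proof.
move=> le; rewrite -subr_ge0 partial_sumB //; apply: sumr_ge0 => n _; exact: term_ge0.
Qed.

Lemma card_block s k : (\sum_(n < k | in_block vQ vL s n) 1 <= 2 ^ vL s)%N.
Proof.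
rewrite -(big_mkord (in_block vQ vL s) (fun=> 1%N)) sum1_count -size_filter.
rewrite -[leqRHS](size_iota (block_start vQ vL s)); apply: uniq_leq_size.
  by rewrite filter_uniq // iota_uniq.
by move=> n; rewrite mem_filter mem_iota => /andP[].
Qed.

(** Block s contributes at most 2^(s^2) terms, each at most 4^s / 2^(s^2+3s+2), that is 2^-(s+2) in
    total; these bounds sum to at most 1/2. *)
Lemma vweight_sum_le k : partial_sum vweight k <= 2^-1.
Proof.
apply: le_trans (geometric_half R k).
pose F s n : R := (4 ^ s)%N%:R / n%:R.
apply: (@le_trans _ _ (\sum_(s < k) \sum_(n < k | in_block vQ vL s n) F s n)).
  rewrite (exchange_big_dep xpredT) //= /partial_sum big_mkcond.
  apply: ler_sum => n _; case: ifP => h; last first.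
    by apply: sumr_ge0 => s _; rewrite divr_ge0.
  have /and3P[_ hb _] := h.
  have lt : (vblock n < k)%N := ltn_trans (lt_block vQ_gt hb) (ltn_ord n).
  rewrite (bigD1 (Ordinal lt)) //= lerDl.
  by apply: sumr_ge0 => s _; rewrite divr_ge0.
apply: ler_sum => s _.
have p2 m : 0 < 2 ^+ m :> R by rewrite exprn_gt0.
apply: (@le_trans _ _ (\sum_(n < k | in_block vQ vL s n)
    (4 ^ s)%N%:R / (2 ^ (vQ s + vL s))%N%:R)).
  apply: ler_sum => n hb; rewrite /F ler_wpM2l // lef_pV2 ?posrE ?ltr0n ?expn_gt0 //.
    rewrite ler_nat; case/andP: hb => h _; apply: leq_trans h.
    exact: block_start_ge vQ_gt _.
  by have := lt_block vQ_gt hb; lia.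
rewrite sumr_const -[X in X <= _]mulr_natl -sum1_card.
apply: (@le_trans _ _ ((2 ^ vL s)%N%:R * ((4 ^ s)%N%:R / (2 ^ (vQ s + vL s))%N%:R))).
  by rewrite ler_wpM2r ?divr_ge0 // ler_nat card_block.
rewrite !natrX (_ : 4%:R = 2 ^+ 2); last by rewrite -natrX.
have [m em] : exists m, m = (2 * s)%N by exists (2 * s)%N.
rewrite (_ : (vQ s + vL s = m + (s + (2 + vL s)))%N); last by rewrite em /vQ; lia.
rewrite -exprM -em exprVn -[s.+2]addn2 !exprD.
have h1 := lt0r_neq0 (p2 (vL s)); have h2 := lt0r_neq0 (p2 m).
have h3 := lt0r_neq0 (p2 s).
rewrite le_eqVlt; apply/orP; left; apply/eqP.
by field; rewrite h1 h2 h3.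
Qed.

Notation psum := (partial_sum (fun=> 1%N)).

Lemma psum_le k : psum k <= 2^-1.
Proof.
apply: le_trans (vweight_sum_le k); apply: ler_sum => n _.
by rewrite ler_wpM2r ?invr_ge0 // ler_nat expn_gt0.
Qed.

Definition vsum : R := sup (range psum).

Lemma has_ubound_psum : has_ubound (range psum).
Proof. by exists 2^-1 => _ [k _ <-]; exact: psum_le. Qed.

Lemma psum_le_vsum k : psum k <= vsum.
Proof. by apply: ub_le_sup; [exact: has_ubound_psum|exists k]. Qed.

Lemma vsum_le (x : R) : (forall k, psum k <= x) -> vsum <= x.
Proof.
by move=> h; apply: ge_sup; [exists (psum 0), 0%N|move=> _ [k _ <-]; exact: h].
Qed.

Lemma lt_vsum (x : R) : x < vsum -> exists k, x < psum k.
Proof.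
by move=> /sup_gt[|_ [k _ <-] h]; [exists (psum 0), 0%N|exists k].
Qed.

(** The term of a number not yet enumerated is still to come. So once [psum k] is within less than
    1/n of the limit, the fate of n is decided. *)
Lemma vsum_gap n k K : enum_by n K -> ~~ enum_by n k -> psum k + n%:R^-1 <= vsum.
Proof.
move=> hK hk; pose m := maxn k K.
have hm : enum_by n m := enumerated_mono (leq_maxr _ _) hK.
apply: le_trans (psum_le_vsum m).
rewrite -lerBrDl partial_sumB ?leq_maxl //.
rewrite (bigD1 (Ordinal (enumerated_lt hm))) /=; last by rewrite hm hk.
by rewrite mul1r lerDl; apply: sumr_ge0 => i _; rewrite divr_ge0.
Qed.

(** Finitely many elements of the domain are enumerated by a common stage, so each finite subsum is
    below some [psum k]; conversely each [psum k] is a finite subsum. *)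
Lemma zeta_vsum V : (forall x, tm_dom V x <-> exists k, enum_by (code x) k) ->
  zeta R V = vsum%:E.
Proof.
move=> hV; rewrite /zeta; set E := [set n | _].
have EP n : E n <-> exists k, enum_by n k.
  split; first by case=> n0 /hV; rewrite code_bin.
  move=> [k hk]; have n0 := enumerated_gt0 hk; split=> //.
  by apply/hV; exists k; rewrite code_bin.
apply/eqP; rewrite eq_le; apply/andP; split.
  apply: ge_ereal_sup => _ [A [fA AE] <-].
  rewrite fsbig_finite //= sumEFin lee_fin.
  set r := finmap.enum_fset _.
  have rE n : n \in r -> exists k, enum_by n k.
    by move=> h; apply/EP/AE; move: h; rewrite in_fset_set // inE.
  have [k hk] : exists k, forall n, n \in r -> enum_by n k.
    elim: (r : seq nat) rE => [|n s IH] rE; first by exists 0%N.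
    have [|k1 h1] := IH; first by move=> m ms; apply: rE; rewrite inE ms orbT.
    have [|k2 h2] := rE n; first by rewrite inE eqxx.
    exists (maxn k1 k2) => m; rewrite inE => /orP[/eqP->|/h1 h].
      exact: enumerated_mono (leq_maxr _ _) h2.
    exact: enumerated_mono (leq_maxl _ _) h.
  apply: le_trans (psum_le_vsum k).
  rewrite /partial_sum -(big_mkord (fun n => enum_by n k) (fun n => 1%:R / n%:R)).
  rewrite -big_filter; under [X in _ <= X]eq_bigr do rewrite mul1r.
  apply: sum_uniq_subset.
  - exact: finmap.fset_uniq.
  - by rewrite filter_uniq // iota_uniq.
  - move=> n /hk h; rewrite mem_filter h mem_iota subn0 /=; exact: enumerated_lt h.
  - by move=> n; rewrite invr_ge0.
have hk k : ((psum k)%:E <= \esum_(n in E) (n%:R^-1 : R)%:E)%E.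
  apply: esum_ge; pose r := [seq n <- iota 0 k | enum_by n k].
  exists [set` r]; last first.
    rewrite -fsbig_seq; last by rewrite filter_uniq // iota_uniq.
    rewrite sumEFin lee_fin big_filter /partial_sum.
    rewrite -(big_mkord (fun n => enum_by n k) (fun n => 1%:R / n%:R)) /index_iota subn0.
    by under eq_bigr do rewrite mul1r.
  split; first exact: finite_seq.
  by move=> n /=; rewrite mem_filter => /andP[h _]; apply/EP; exists k.
(* This bound excludes the value -oo of the series; the case +oo is trivial. *)
have : ((psum 0)%:E <= \esum_(n in E) (n%:R^-1 : R)%:E)%E := hk 0%N.
case: (\esum_(n in E) _) hk => [x| |] hk h //; last exact: leey.
by rewrite lee_fin; apply: vsum_le => k; have := hk k; rewrite lee_fin.
Qed.

End Sums.

(** * Asymptotic randomness and failure of randomness of the sum *)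

Lemma first_bitsP (R : realType) (z : R) m : 0 < z <= 1 ->
  exists2 v : nat, code (first_bits z m) = (2 ^ m + v)%N &
    v%:R < z * 2 ^+ m <= v%:R + 1.
Proof.
move=> z01; exists (\sum_(i < m) unending_bit z i * 2 ^ (m - i.+1))%N.
  rewrite code_sum size_mkseq; congr addn; apply: eq_bigr => i _.
  by rewrite nth_mkseq.
have p2 : 0 < 2 ^+ m :> R by rewrite exprn_gt0.
have := unending_bitP m z01; set s := \sum_(i < m) _ => /= hs.
have -> : (\sum_(i < m) unending_bit z i * 2 ^ (m - i.+1))%N%:R = s * 2 ^+ m :> R.
  rewrite natr_sum big_distrl /=; apply: eq_bigr => i _.
  rewrite natrM natrX -mulrA; congr (_ * _).
  by rewrite -[in X in _ = _ * X](subnK (ltn_ord i)) exprD mulrCA mulVf ?mulr1 ?expf_neq0 // pnatr_eq0.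
case/andP: hs => h1 h2; rewrite ltr_pM2r // h1 /=.
by rewrite -[X in _ <= _ + X](mulVf (lt0r_neq0 p2)) -mulrDl ler_pM2r // -exprVn.
Qed.

Section Randomness.
Variables (R : realType) (T : machine).
Notation psum := (partial_sum R T (fun=> 1%N)).
Notation wsum := (partial_sum R T vweight).
Notation vblock := (block vQ vL).
Notation vstart := (block_start vQ vL).

Lemma fact_gt0R k : 0 < (k`!)%:R :> R.
Proof. by rewrite ltr0n fact_gt0. Qed.

Lemma run_nonzero y k : (0 < y)%N -> run T y k != 0%N ->
  exists2 x, computes T (bin y) x & run T y k = code x.
Proof.
move=> y0 h; have [x e] : exists x, run T y k = code x.
  by rewrite runE in h *; case: (step _) h => // _; eexists.
by exists x => //; apply: run_computes e.
Qed.

Lemma lt_square_exp s : (s < 2 ^ (s * s))%N.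
Proof.
apply: leq_trans (ltn_expl s (ltnSn 1)) _; rewrite leq_exp2l //; nia.
Qed.

(** T halts somewhere, since by universality it imitates a machine that halts on every input. *)
Lemma vsum_gt0 : universal (fun _ => True) T -> 0 < vsum R T.
Proof.
move=> Tu.
have [M hM] := @search_machine (fun _ _ => true) (fun _ _ => 0%N)
  (computable_const 1) (computable_const 0).
have [c hc] := Tu M I.
have cM : computes M [::] (bin 0) by apply/hM; exists 0%N.
have [p [hp _]] := hc _ _ cM.
move: hp; rewrite -(bin_code p) => /computes_run[k hk].
have y0 := code_gt0 p; set y := code p in hk y0.
(* Block y is large enough to contain the offset y, since y < 2^(y^2). *)
have hn K : (k <= K)%N -> (vstart y + y < K)%N -> enumerated T (vstart y + y) K.
  move=> le lt; rewrite enumerated_block ?lt_square_exp // lt /=.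
  have h0 : run T y k != 0%N by rewrite hk -lt0n code_gt0.
  by rewrite (run_stable h0 le).
have := @vsum_gap R T (vstart y + y) 0 (maxn k (vstart y + y).+1).
rewrite /partial_sum big_ord0 add0r => h.
apply: lt_le_trans (h _ _); last by apply/negP => /enumerated_lt.
  by rewrite invr_gt0 ltr0n; lia.
by apply: hn; [exact: leq_maxl|exact: leq_maxr].
Qed.

Lemma vsum_le_half : vsum R T <= 2^-1.
Proof. by apply: vsum_le => k; apply: psum_le. Qed.

Lemma overtake_testE n k m v : run T n k = (2 ^ m + v)%N -> (v < 2 ^ m)%N ->
  overtake_test T n k = (v%:R < psum k * 2 ^+ m :> R).
Proof.
move=> e lt; have lg : trunc_log 2 (2 ^ m + v)%N = m.
  by apply: trunc_log_eq => //; rewrite leq_addr expnS mul2n -addnn ltn_add2l.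
have -> : overtake_test T n k = (v * k`! < weighted_sum T (fun=> 1) k * 2 ^ m)%N.
  by rewrite /overtake_test e lg addKn; case: eqP => //; have := expn_gt0 2 m; lia.
rewrite -(ltr_nat R) !natrM weighted_sumE natrX.
by rewrite mulrC -mulrA ltr_pM2l ?fact_gt0R.
Qed.

Lemma asymptotic_bound (t : R) (c : nat) : 1 < t ->
  exists2 d : R, 0 <= d & forall s m : nat, (m < s * s + 5 * s + 7)%N ->
    m%:R / t - d <= (s * s)%N%:R - c%:R.
Proof.
move=> t1; have t0 : 0 < t by lra.
have e0 : 0 < t - 1 by lra.
exists (c%:R + (7 + 25 / (t - 1))).
  by rewrite addr_ge0 // addr_ge0 // divr_ge0 // ltW.
move=> s m; rewrite -(ltr_nat R) !natrD !natrM => hm.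
rewrite lerBlDr ler_pdivrMr //.
set x : R := s%:R in hm *; set q := 25 / (t - 1).
have q0 : 0 <= q by rewrite divr_ge0 // ltW.
have hq : q * (t - 1) = 25 by rewrite /q mulfVK // lt0r_neq0.
(* The loss 5s is absorbed by the excess (t-1) s^2 up to a constant: expand the square of (t-1) s -
   5/2. *)
have key : 5 * x <= (t - 1) * x * x + q.
  rewrite -(ler_pM2r e0) [X in _ <= X]mulrDl hq.
  have := sqr_ge0 ((t - 1) * x - 5 / 2); rewrite expr2; nra.
have -> : x * x - c%:R + (c%:R + (7 + q)) = x * x + 7 + q by ring.
apply: le_trans (ltW hm) _; nra.
Qed.

Lemma vsum_asymptotically_random :
  universal (fun _ => True) T -> asymptotically_random T (vsum R T).
Proof.
move=> Tu t _ t1.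
have [M hM] := fresh_output_machine T; have [c hc] := Tu M I.
have [d d0 hd] := asymptotic_bound c t1; exists d => // m m0.
have z01 : 0 < vsum R T <= 1.
  by rewrite vsum_gt0 //= (le_trans vsum_le_half) //; lra.
apply: le_ereal_inf_tmp => _ [w hw <-]; rewrite lee_fin.
set z := vsum R T in z01 hw *; have [v ev /andP[v1 v2]] := first_bitsP m z01.
have p2 : 0 < 2 ^+ m :> R by rewrite exprn_gt0.
have vlt : (v < 2 ^ m)%N.
  rewrite -(ltr_nat R) natrX; apply: lt_le_trans v1 _.
  by rewrite ler_piMl ?(ltW p2) //; case/andP: z01.
have hw' := hw; rewrite -{1}(bin_code w) in hw'.
have [k1 hk1] := computes_run hw'; rewrite ev in hk1.
have [k2 hk2] : exists k, v%:R / 2 ^+ m < psum k.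
  by apply: lt_vsum; rewrite ltr_pdivrMr.
have ex : exists k, overtake_test T (code w) k.
  exists (maxn k1 k2).
  have r0 : run T (code w) k1 != 0%N by rewrite hk1; have := expn_gt0 2 m; lia.
  rewrite (@overtake_testE _ _ m v) //; last by rewrite (run_stable r0 (leq_maxl _ _)).
  rewrite -ltr_pdivrMr //; apply: lt_le_trans hk2 _.
  exact: partial_sum_mono (leq_maxr _ _).
(* At the least successful stage k, the program w has already produced the first m bits of z, and M
   outputs the fresh string of this stage. *)
have [k hk mink] := ex_minnP ex.
have [x cx rx] : exists2 x, computes T (bin (code w)) x & run T (code w) k = code x.
  by apply: run_nonzero (code_gt0 w) _; case/andP: hk.
have ex' : x = first_bits z m by apply: computes_fun cx hw'.
rewrite ex' ev in rx; move: hk; rewrite (overtake_testE rx vlt) => hk.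
have cM : computes M w (bin (fresh_output T (code w) k)).
  apply/hM; exists k; split=> //; first by rewrite (overtake_testE rx vlt).
  by move=> j jk; apply/negP => /mink; rewrite leqNgt jk.
have [p [hp sp]] := hc _ _ cM.
have lg : trunc_log 2 (2 ^ m + v)%N = m.
  by apply: trunc_log_eq => //; rewrite leq_addr expnS mul2n -addnn ltn_add2l.
move: hp; rewrite /fresh_output rx lg; set s := max_block m => hp.
have [ms sm] := max_blockP m; rewrite -/s in ms sm.
suff ssp : (s * s <= size p)%N.
  apply: le_trans (hd _ _ ms) _; rewrite lerBlDr -natrD ler_nat.
  exact: leq_trans sp.
rewrite leqNgt; apply/negP => psz.
have y0 := code_gt0 p; set y := code p in y0.
have ylt : (y < 2 ^ vL s)%N.
  rewrite /vL; apply: leq_trans (trunc_log_ltn y (ltnSn 1)) _.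
  by rewrite leq_exp2l // log_code.
have s0 : (0 < s)%N by case: (posnP s) psz => // ->.
have hp' := hp; rewrite -{1}(bin_code p) -/y in hp'.
have [k' hk'] := computes_run hp'.
rewrite code_bin // in hk'.
(* By stability, any nonzero run on y gives the fresh output. At stage k the run on y is itself a
   summand of the sum below the fresh output, so it is still 0. *)
have ry k0 : run T y k0 != 0%N ->
    run T y k0 = (\sum_(y < 2 ^ vL s) run T y k).+1.
  move=> h0; have h1 : run T y k' != 0%N by rewrite hk'.
  by rewrite -hk' -(run_stable h0 (leq_maxl k0 k')) (run_stable h1 (leq_maxr k0 k')).
have r0 : run T y k = 0%N.
  apply/eqP/negPn/negP => /ry.
  by rewrite (bigD1 (Ordinal ylt)) //= => /eqP; rewrite ltn_eqF // ltnS leq_addr.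
(* Hence the element of block s with offset y appears only after stage k. Its term is at least 2^-m,
   whereas z exceeds [psum k] by less than 2^-m because [psum k] has overtaken v / 2^m. *)
have := @vsum_gap R T (vstart s + y) k (maxn k' (vstart s + y).+1).
rewrite !enumerated_block // r0 eqxx andbF leq_maxr /=.
rewrite (@run_stable T y k') ?hk' ?leq_maxl // => /(_ isT isT) gap.
have ns : ((vstart s + y)%:R : R) <= 2 ^+ m.
  rewrite -natrX ler_nat; apply: (@leq_trans (2 ^ (vQ s + vL s).+1)).
    by rewrite -block_startE leq_add2l (leq_trans (ltnW ylt)) // leq_exp2l.
  by rewrite leq_exp2l // /vQ /vL; move: (sm s0); clear; lia.
have n0 : 0 < ((vstart s + y)%:R : R) by rewrite ltr0n addn_gt0 y0 orbT.
have inv : (2 ^+ m)^-1 <= ((vstart s + y)%:R : R)^-1 by rewrite lef_pV2.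
have : psum k * 2 ^+ m + 1 <= z * 2 ^+ m.
  rewrite -[X in _ + X](mulVf (lt0r_neq0 p2)) -mulrDl ler_pM2r //.
  by apply: le_trans gap; rewrite lerD2l.
by move=> h; lra.
Qed.

Lemma describesE r a k :
  describes T r a k = (a%:R <= wsum k * 2 ^+ (r * r) :> R).
Proof.
rewrite /describes -(ler_nat R) !natrM weighted_sumE natrX.
by rewrite mulrC -mulrA ler_pM2l ?fact_gt0R.
Qed.

(** A missing element of a block b < r would alone have weighted term at least 2^-(b^2+b+3), which
    is at least 2^-(r^2) because b <= r - 1 and r >= 3. So all missing terms carry a weight of at
    least 4^r, and dividing it out gains 2r bits. *)
Lemma psum_gap r k K : (3 <= r)%N -> (k <= K)%N ->
  wsum K - wsum k < (2 ^+ (r * r))^-1 ->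
  psum K - psum k <= (2 ^+ (r * r + 2 * r))^-1.
Proof.
move=> r3 le; rewrite !partial_sumB // => h.
have p2 m : 0 < 2 ^+ m :> R by rewrite exprn_gt0.
have big_r (n : 'I_K) : enumerated T n K && ~~ enumerated T n k -> (r <= vblock n)%N.
  move=> hn; rewrite leqNgt; apply/negP => lt.
  move: h; apply/negP; rewrite -leNgt (bigD1 n) //=.
  rewrite -[X in X <= _]addr0 lerD //; last by apply: sumr_ge0 => i _; exact: term_ge0.
  have /andP[hK _] := hn; have n0 : 0 < (n : nat)%:R :> R by rewrite ltr0n (enumerated_gt0 hK).
  have /and3P[_ /andP[_ hb] _] := hK.
  rewrite ler_pdivlMr // mulrC ler_pdivrMr // /vweight -natrX -natrM ler_nat.
  set b := vblock n in hb lt *.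
  apply: (@leq_trans (2 ^ (vQ b + vL b).+1)).
    by rewrite -block_startE (leq_trans (ltnW hb)) // leq_add2l leq_exp2l.
  rewrite (_ : 4%N = 2 ^ 2)%N // -expnM -expnD leq_exp2l // /vQ /vL; nia.
have q0 : 0 <= (2 ^+ (2 * r))^-1 :> R by rewrite invr_ge0 ltW.
rewrite exprD invfM mulrC; apply: le_trans (ler_wpM2l q0 (ltW h)).
rewrite big_distrr /=; apply: ler_sum => n hn.
rewrite mulrA ler_wpM2r ?invr_ge0 // mulrC ler_pdivlMr // mul1r /vweight -natrX ler_nat.
by rewrite (_ : 4%N = 2 ^ 2)%N // -expnM leq_exp2l // leq_mul2l big_r.
Qed.

Lemma vsum_not_random U :
  0 < vsum R T -> universal self_delimiting U -> ~ random U (vsum R T).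
Proof.
move=> z0 Uu [c c0 hc].
have [M Msd hM] := description_machine T; have [d hd] := Uu M Msd.
(* The program for r^2 + 2r bits has length at most r^2 + r + 3 + d, while randomness demands at
   least r^2 + 2r - c; so r > c + d + 3 is contradictory. *)
pose r := (Num.Def.archi_bound c + d + 3)%N.
have cr : c + d%:R + 3 < r%:R.
  by rewrite /r !natrD; have := archi_boundP c0; lra.
have r3 : (3 <= r)%N by rewrite leq_addl.
clearbody r.
(* The numerator a to be described is the largest one for which some partial sum of O reaches a /
   2^(r^2). *)
pose P (a : nat) := `[< exists k, describes T r a k >].
have P0 : exists a, P a by exists 0%N; apply/asboolP; exists 0%N; rewrite /describes mul0n.
have p2 m : 0 < 2 ^+ m :> R by rewrite exprn_gt0.
have Plt a : P a -> (a < 2 ^ (r * r))%N.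
  move=> /asboolP[k]; rewrite describesE -(ltr_nat R) natrX => h.
  apply: le_lt_trans h _; rewrite gtr_pMl //.
  by have := vweight_sum_le R T k; lra.
have [|a /asboolP exk maxa] := @ex_maxnP P (2 ^ (r * r)) P0.
  by move=> a /Plt/ltnW.
have [k hk mink] := ex_minnP exk.
pose m := (r * r + 2 * r)%N.
(* By maximality a + 1 is never reached, so after stage k the weighted sum grows by less than
   2^-(r^2). *)
have gap K : psum K <= psum k + (2 ^+ m)^-1.
  case: (leqP K k) => [le|/ltnW le].
    by apply: le_trans (partial_sum_mono _ _ _ le) _; rewrite lerDl invr_ge0 ltW.
  rewrite -lerBlDl; apply: psum_gap => //.
  have : ~~ describes T r a.+1 K.
    by apply/negP => h; have := maxa a.+1; rewrite ltnn => H; apply/notF/H/asboolP; exists K.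
  move: hk; rewrite !describesE -ltNge -natr1 => h1 h2.
  by rewrite -[X in _ < X]mul1r ltr_pdivlMr // mulrBl; lra.
have zk : vsum R T <= psum k + (2 ^+ m)^-1 by apply: vsum_le.
have kz := psum_le_vsum R T k.
have z01 : 0 < vsum R T <= 1.
  by rewrite z0 /= (le_trans vsum_le_half) //; lra.
have [v ev /andP[v1 v2]] := first_bitsP m z01.
pose F := (weighted_sum T (fun=> 1) k * 2 ^ m %/ k`!)%N.
have /andP[F1 F2] : F%:R <= psum k * 2 ^+ m < F%:R + 1.
  rewrite -(ler_pM2l (fact_gt0R k)) -(ltr_pM2l (fact_gt0R k) (psum k * _)).
  rewrite mulrA -weighted_sumE natr1 -natrX -!natrM ler_nat ltr_nat.
  by apply/andP; split; [rewrite mulnC leq_divM|rewrite [ltnRHS]mulnC ltn_ceil ?fact_gt0].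
have z2 : vsum R T * 2 ^+ m <= psum k * 2 ^+ m + 1.
  rewrite -[X in _ + X](mulVf (lt0r_neq0 (p2 m))) -mulrDl.
  by rewrite ler_pM2r.
have z3 : psum k * 2 ^+ m <= vsum R T * 2 ^+ m by rewrite ler_pM2r.
(* Rounding [psum k] down and replacing z by [psum k] shift the prefix by at most one in either
   direction, so the correction v + 1 - F is 0, 1 or 2. *)
have Fv : (F <= v.+1)%N by rewrite -(ler_nat R) -natr1; lra.
have vF : (v < F.+2)%N by rewrite -(ltr_nat R) -[F.+2%:R]natr1 -natr1; lra.
have Pa : P a by apply/asboolP; exists k.
have nk j : (j < k)%N -> ~~ describes T r a j.
  by move=> jk; apply/negP => /mink; rewrite leqNgt jk.
have b4 : (v.+1 - F < 4)%N by rewrite ltnS leq_subLR addn3 (leq_trans vF).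
have [x sx] := description_machineP hM (Plt a Pa) hk nk b4.
cbv zeta; rewrite -/m -/F subnKC //= -ev bin_code => /hd[p [hp sp]].
have m0 : (0 < m)%N by rewrite addn_gt0 !muln_gt0 (ltn_trans _ r3).
have : ((m%:R - c)%:E <= (size p)%:R%:E :> \bar R)%E.
  by apply: le_trans (hc m m0) _; apply: ge_ereal_inf; exists (size p)%:R%:E => //; exists p.
rewrite lee_fin => h.
have : (size p)%:R <= (r * r + r + 3 + d)%N%:R :> R by rewrite ler_nat -sx.
move: h; rewrite /m !natrD !natrM => h1 h2.
by move: cr h1 h2; clear; lra.
Qed.
End Randomness.

Theorem theorem50 (R : realType) (T U : machine)
  (T_universal : universal (fun _ => True) T)
  (U_self_delimiting : self_delimiting U)
  (U_universal : universal self_delimiting U) :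
  exists V : machine, self_delimiting V /\
    exists z : R, [/\ zeta R V = z%:E, 0 < z < 1,
                      asymptotically_random T z & ~ random U z].
Proof.
have [V [Vsd hV]] := self_delimiting_machine T.
have z0 := vsum_gt0 R T_universal.
exists V; split=> //; exists (vsum R T); split.
- exact: zeta_vsum.
- by rewrite z0 (le_lt_trans (vsum_le_half R T)) //; lra.
- exact: vsum_asymptotically_random.
- exact: vsum_not_random.
Qed.
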